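(* Define homogeneous polynomials in $\mathbb{C}[X,Y]$ by $$F_{30} = X^{30} + 522\,(X^{25} Y^5 - X^5 Y^{25}) - 10005\,(X^{20} Y^{10} + X^{10} Y^{20}) + Y^{30},$$ $$F_{20} = X^{20} - 228\,(X^{15} Y^5 - X^5 Y^{15}) + 494\, X^{10} Y^{10} + Y^{20},$$ $$F_{12} = XY\,(X^{10} + 11 X^5 Y^5 - Y^{10}).$$ For $d \in \{30, 20, 12\}$ let $C_d \subset \mathbb{P}^2_{\mathbb{C}}$ be the plane curve defined by $Z^{d} + F_{d}(X,Y) = 0$. Then $|\mathrm{Aut}(C_d)| = 60d$ for $d = 30, 20, 12$. Furthermore: - $\mathrm{Aut}(C_{30}) \cong \mathbb{Z}_{15} \times \mathrm{SL}(2,5)$; - $\mathrm{Aut}(C_{20}) \cong \mathbb{Z}_5 \times (\mathrm{SL}(2,5) \rtimes \mathbb{Z}_2)$ for some semidirect product $\mathrm{SL}(2,5) \rtimes \mathbb{Z}_2$, i.e. for some action of $\mathbb{Z}_2$ on $\mathrm{SL}(2,5)$ by group automorphisms; - $\mathrm{Aut}(C_{12}) \cong \mathbb{Z}_3 \times (\mathrm{SL}(2,5) \rtimes \mathbb{Z}_2)$ for some semidirect product $\mathrm{SL}(2,5) \rtimes \mathbb{Z}_2$, i.e. for some action of $\mathbb{Z}_2$ on $\mathrm{SL}(2,5)$ by group automorphisms.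
   Context: The base field is $\mathbb{C}$, and $(X:Y:Z)$ are homogeneous coordinates on $\mathbb{P}^2$. $\mathrm{Aut}(C)$ denotes the group of automorphisms of the smooth projective plane curve $C$ over $\mathbb{C}$; for a smooth plane curve of degree at least $4$ it is identified with the group of elements of $\mathrm{PGL}(3,\mathbb{C}) = \mathrm{Aut}(\mathbb{P}^2)$ that map $C$ to itself. $\mathbb{Z}_n$ denotes the cyclic group of order $n$, and $\mathrm{SL}(2,5)$ denotes the group of $2 \times 2$ matrices of determinant $1$ over the field with $5$ elements (the binary icosahedral group, of order $120$). *)

(* Defs.v *)
From HB Require Import structures.
From mathcomp Require Import all_boot all_order all_algebra all_fingroup.
From mathcomp Require Import boolp classical_sets cardinality reals.
From mathcomp Require Import complex mpoly.

Set Implicit Arguments.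
Unset Strict Implicit.
Unset Printing Implicit Defensive.

Import generic_quotient GRing.Theory.
Local Open Scope ring_scope.
Local Open Scope quotient_scope.

Definition isomorphic (G H : groupType) : Prop :=
  exists f : {multiplicative G -> H}, bijective f.

Section Proportional.
Variables (K : fieldType) (m n : nat).

Definition proportional (A B : 'M[K]_(m, n)) : bool :=
  `[< exists2 c : K, c != 0 & B = c *: A >].

Lemma proportional_refl : reflexive proportional.
Proof. by move=> A; apply/asboolP; exists 1; rewrite ?oner_eq0 ?scale1r. Qed.

Lemma proportional_sym : ssrbool.symmetric proportional.
Proof.
suff h A B : proportional A B -> proportional B A.
  by move=> A B; apply/idP/idP; apply: h.
case/asboolP=> c c0 ->; apply/asboolP; exists c^-1; first by rewrite invr_eq0.
by rewrite scalerA mulVf ?scale1r.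
Qed.

Lemma proportional_trans : transitive proportional.
Proof.
move=> B A D /asboolP[c c0 ->] /asboolP[e e0 ->]; apply/asboolP.
by exists (e * c); rewrite ?mulf_neq0 ?scalerA.
Qed.

End Proportional.

Section ProjectiveGeometry.
Variables (K : fieldType) (n : nat).

Definition hvec := {v : 'cV[K]_n | v != 0}.
HB.instance Definition _ := SubChoice.on hvec.

Definition hvec_equiv (u v : hvec) : bool := proportional (val u) (val v).

Canonical hvec_equiv_rel := EquivRel hvec_equiv
  (fun u => proportional_refl (val u))
  (fun u v => proportional_sym (val u) (val v))
  (fun u v w => @proportional_trans _ _ _ (val u) (val v) (val w)).

(* The points of the projective space of dimension n - 1. *)
Definition proj_space := {eq_quot hvec_equiv}.
HB.instance Definition _ := Choice.on proj_space.
HB.instance Definition _ := EqQuotient.on proj_space.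

Lemma pi_projP (u v : hvec) :
  reflect (exists2 c : K, c != 0 & val v = c *: val u)
          (\pi_proj_space u == \pi_proj_space v).
Proof. by rewrite piE; apply: asboolP. Qed.

Definition GL := {A : 'M[K]_n | A \in unitmx}.
HB.instance Definition _ := SubChoice.on GL.

Definition GL1 : GL := exist (fun M => is_true (M \in unitmx)) 1%:M (unitmx1 K n).

Lemma GLM_subproof (A B : GL) : val A *m val B \in unitmx.
Proof. by rewrite unitmx_mul (valP A) (valP B). Qed.
Definition GLM (A B : GL) : GL := exist (fun M => is_true (M \in unitmx)) _ (GLM_subproof A B).

Lemma GLV_subproof (A : GL) : invmx (val A) \in unitmx.
Proof. by rewrite unitmx_inv (valP A). Qed.
Definition GLV (A : GL) : GL := exist (fun M => is_true (M \in unitmx)) _ (GLV_subproof A).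

Lemma GLMA : associative GLM.
Proof. by move=> A B D; apply/val_inj/mulmxA. Qed.
Lemma GL1M : left_id GL1 GLM.
Proof. by move=> A; apply/val_inj/mul1mx. Qed.
Lemma GLM1 : right_id GL1 GLM.
Proof. by move=> A; apply/val_inj/mulmx1. Qed.
Lemma GLVM : left_inverse GL1 GLV GLM.
Proof. by move=> A; apply/val_inj/mulVmx/(valP A). Qed.
Lemma GLMV : right_inverse GL1 GLV GLM.
Proof. by move=> A; apply/val_inj/mulmxV/(valP A). Qed.

HB.instance Definition _ := isGroup.Build GL GLMA GL1M GLM1 GLVM GLMV.

Definition GL_equiv (A B : GL) : bool := proportional (val A) (val B).

Canonical GL_equiv_rel := EquivRel GL_equiv
  (fun A => proportional_refl (val A))
  (fun A B => proportional_sym (val A) (val B))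
  (fun A B D => @proportional_trans _ _ _ (val A) (val B) (val D)).

Definition PGL := {eq_quot GL_equiv}.
HB.instance Definition _ := Choice.on PGL.
HB.instance Definition _ := EqQuotient.on PGL.

Definition PGL1 : PGL := \pi_PGL (1%g : GL).
Definition PGLM (g h : PGL) : PGL := \pi_PGL (repr g * repr h)%g.
Definition PGLV (g : PGL) : PGL := \pi_PGL ((repr g)^-1)%g.

Lemma pi_PGLP (A B : GL) :
  reflect (exists2 c : K, c != 0 & val B = c *: val A)
          (\pi_PGL A == \pi_PGL B).
Proof. by rewrite piE; apply: asboolP. Qed.

Lemma repr_PGL (A : GL) :
  exists2 c : K, c != 0 & val (repr (\pi_PGL A)) = c *: val A.
Proof. by apply/pi_PGLP; rewrite reprK. Qed.

Lemma pi_PGLM (A B : GL) :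
  PGLM (\pi_PGL A) (\pi_PGL B) = \pi_PGL (A * B)%g.
Proof.
have [a a0 eA] := repr_PGL A; have [b b0 eB] := repr_PGL B.
apply/esym/eqP/pi_PGLP; exists (a * b); first by rewrite mulf_neq0.
by rewrite /= eA eB -scalemxAl -scalemxAr scalerA.
Qed.

Lemma pi_PGLV (A : GL) : PGLV (\pi_PGL A) = \pi_PGL (A^-1)%g.
Proof.
have [a a0 eA] := repr_PGL A.
apply/esym/eqP/pi_PGLP; exists a^-1; first by rewrite invr_eq0.
rewrite /= eA invmxZ //.
by rewrite -eA; apply: (valP (repr (\pi_PGL A))).
Qed.

Lemma PGL_ind (P : PGL -> Prop) : (forall A, P (\pi_PGL A)) -> forall g, P g.
Proof. by move=> h g; rewrite -[g]reprK. Qed.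

Lemma PGLMA : associative PGLM.
Proof.
elim/PGL_ind=> A; elim/PGL_ind=> B; elim/PGL_ind=> D.
by rewrite !pi_PGLM mulgA.
Qed.
Lemma PGL1M : left_id PGL1 PGLM.
Proof. by elim/PGL_ind=> A; rewrite pi_PGLM mul1g. Qed.
Lemma PGLM1 : right_id PGL1 PGLM.
Proof. by elim/PGL_ind=> A; rewrite pi_PGLM mulg1. Qed.
Lemma PGLVM : left_inverse PGL1 PGLV PGLM.
Proof. by elim/PGL_ind=> A; rewrite pi_PGLV pi_PGLM mulVg. Qed.
Lemma PGLMV : right_inverse PGL1 PGLV PGLM.
Proof. by elim/PGL_ind=> A; rewrite pi_PGLV pi_PGLM mulgV. Qed.

HB.instance Definition _ := isGroup.Build PGL PGLMA PGL1M PGLM1 PGLVM PGLMV.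

Lemma act_subproof (A : GL) (v : hvec) : val A *m val v != 0.
Proof.
apply: contraNneq (valP v) => Av0.
by rewrite -(mulKmx (valP A) (val v)) Av0 mulmx0.
Qed.
Definition GL_act (A : GL) (v : hvec) : hvec := exist (fun w => is_true (w != 0)) _ (act_subproof A v).

Definition PGL_act (g : PGL) (p : proj_space) : proj_space :=
  \pi_proj_space (GL_act (repr g) (repr p)).

Lemma PGL_act_pi (A : GL) (v : hvec) :
  PGL_act (\pi_PGL A) (\pi_proj_space v) = \pi_proj_space (GL_act A v).
Proof.
have [a a0 eA] := repr_PGL A.
have [b b0 ev] : exists2 b : K, b != 0 &
    val (repr (\pi_proj_space v)) = b *: val v.
  by apply/pi_projP; rewrite reprK.
apply/esym/eqP/pi_projP.
exists (a * b); first by rewrite mulf_neq0.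
by rewrite /= eA ev -scalemxAl -scalemxAr scalerA.
Qed.

Lemma proj_ind (P : proj_space -> Prop) :
  (forall v, P (\pi_proj_space v)) -> forall p, P p.
Proof. by move=> h p; rewrite -[p]reprK. Qed.

Lemma PGL_act1 : PGL_act 1%g = id.
Proof.
apply/funext; elim/proj_ind=> v; rewrite PGL_act_pi; congr (\pi _).
by apply: val_inj; rewrite /= mul1mx.
Qed.

Lemma PGL_actM g h : PGL_act (g * h)%g = PGL_act g \o PGL_act h.
Proof.
apply/funext; elim/proj_ind=> v; elim/PGL_ind: g => A; elim/PGL_ind: h => B.
rewrite [(_ * _)%g]pi_PGLM /= !PGL_act_pi; congr (\pi _).
by apply: val_inj; rewrite /= mulmxA.
Qed.

(* Only meaningful for homogeneous P, where one representative of the point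
   vanishes if and only if all do. *)
Definition zero_locus (P : {mpoly K[n]}) : set proj_space :=
  [set p | forall v : hvec, \pi_proj_space v = p ->
                            P.@[fun i => val v i 0] = 0].

Definition stabilizes (C : set proj_space) : pred PGL :=
  fun g => `[< PGL_act g @` C = C >]%classic.

(* The elements of PGL that map C to itself. If C is the set of points of a
   smooth plane curve of degree at least 4 over an algebraically closed field,
   then every automorphism of the curve is the restriction of exactly one of
   them, so this is the automorphism group of the curve. *)
Definition Aut_curve (C : set proj_space) := {g : PGL | stabilizes C g}.

Lemma stabilizes_group_closed (C : set proj_space) : group_closed (stabilizes C).
Proof.
split=> [|g h].
  by apply/asboolP; rewrite PGL_act1 image_id.
move=> /asboolP gC /asboolP hC; apply/asboolP.
have hVC : (PGL_act h^-1%g @` C = C)%classic.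
  by rewrite -[in LHS]hC image_comp -PGL_actM mulVg PGL_act1 image_id.
by rewrite PGL_actM -image_comp hVC.
Qed.

HB.instance Definition _ C := SubChoice.on (Aut_curve C).
HB.instance Definition _ C :=
  SubChoice_isSubGroup.Build PGL (stabilizes C) (Aut_curve C)
    (stabilizes_group_closed C).

End ProjectiveGeometry.

Section Curves.
Variable K : fieldType.

Let X : {mpoly K[3]} := 'X_(inord 0).
Let Y : {mpoly K[3]} := 'X_(inord 1).
Let Z : {mpoly K[3]} := 'X_(inord 2).

Definition F30 : {mpoly K[3]} :=
  X ^+ 30 + 522%:R * (X ^+ 25 * Y ^+ 5 - X ^+ 5 * Y ^+ 25)
  - 10005%:R * (X ^+ 20 * Y ^+ 10 + X ^+ 10 * Y ^+ 20) + Y ^+ 30.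

Definition F20 : {mpoly K[3]} :=
  X ^+ 20 - 228%:R * (X ^+ 15 * Y ^+ 5 - X ^+ 5 * Y ^+ 15)
  + 494%:R * (X ^+ 10 * Y ^+ 10) + Y ^+ 20.

Definition F12 : {mpoly K[3]} :=
  X * Y * (X ^+ 10 + 11%:R * (X ^+ 5 * Y ^+ 5) - Y ^+ 10).

Definition C30 := zero_locus (Z ^+ 30 + F30).
Definition C20 := zero_locus (Z ^+ 20 + F20).
Definition C12 := zero_locus (Z ^+ 12 + F12).

End Curves.

Arguments C30 K : clear implicits.
Arguments C20 K : clear implicits.
Arguments C12 K : clear implicits.

Definition SL25 : {set {'GL_2['F_5]}} := [set A | \det (GLval A) == 1].

Lemma SL25_group_set : group_set SL25.
Proof.
apply/group_setP; split=> [|A B]; rewrite !inE ?det1 //.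
by move=> /eqP dA /eqP dB; rewrite GL_MxE det_mulmx dA dB mulr1.
Qed.
Canonical SL25_group := Group SL25_group_set.

(* Main.v *)
From Stdlib Require Import ZArith.
Require Import Defs.
From mathcomp Require Import all_boot all_order all_algebra all_fingroup.
From mathcomp Require Import boolp classical_sets cardinality reals complex.
From mathcomp Require Import mpoly functions separable cyclic ssrZ zify ring.

Set Implicit Arguments.
Unset Strict Implicit.
Unset Printing Implicit Defensive.

(* Let F be one of the three Klein forms and d its degree. If A maps the curve
   Z^d + F(X, Y) = 0 to itself, then Z^d + F is an eigenvector of A, because at a
   fixed (x, y) with F(x, y) <> 0 it is, as a polynomial in Z, determined by its
   d simple roots. Differentiating along the preimage of (0, 0, 1) makes a
   combination of F_x and F_y a (d-1)-st power of a linear form, which the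
   vanishing pattern of the coefficients of F forbids; hence A is proportional to
   diag(B, 1) with F o B = F.

   The 2 x 2 matrices B are classified through Hessians: Hess F20 is a multiple of
   F12^3 and Hess F30 of F12^3 F20, so B maps (1, 0) to a root of F12. These twelve
   roots are permuted transitively by the two-dimensional Weil representation of
   SL(2,5), which preserves the three forms, and an upper triangular B preserving F
   is a scalar times a power of the image of a transvection. So the group of all B
   consists of the d-th roots of unity times the image of SL(2,5), and what remains
   is to split off the odd part of the scalars. *)

(** Every identity between the Klein forms becomes a computation with lists of integers:
    coefficients lie in [Z], or in Z[z] with z^5 = 1, and [vm_compute] settles them for all fields
    at once. The Weil representation is chosen because it gives a closed formula for the matrix of
    each element of SL(2,5); multiplicativity then follows from a check with two generators on the
    left, without a presentation of the group. In its exponents modulo 5, the factor 3 is 1/2 and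
    c^3 is 1/c, so [weil_entry] contains the usual kernel z^((a x^2 - 2 x y + d y^2) / (2 c)),
    antisymmetrised in y. The only scalars in the image of SL(2,5) are 1 and -1, so d scalars and
    120 matrices give 60 d products. If d = 30, the sign is absorbed by SL(2,5) and the scalars of
    order dividing 15 split off. If d = 4 m with m odd, the scalar i remains; it is not in the image
    and enlarges SL(2,5) by a factor Z_2. *)

(** * Binary forms as coefficient lists *)

Section FormLists.
Import GRing.Theory.
Local Open Scope ring_scope.
Variables (T : Type) (zero : T) (add mul : T -> T -> T).

Fixpoint form_add (p q : seq T) : seq T :=
  match p, q with
  | [::], _ => q
  | _, [::] => p
  | a :: p', b :: q' => add a b :: form_add p' q'
  end.

(** The length of a list encodes the degree. The singleton case and the padding with zeros keep a
    product at length [(size p).-1 + size q], even when extreme coefficients vanish. *)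
Fixpoint form_mul (p q : seq T) : seq T :=
  match p with
  | [::] => [::]
  | [:: a] => map (mul a) q
  | a :: p' => form_add (map (mul a) q ++ nseq (size p') zero) (zero :: form_mul p' q)
  end.

(* Returns F(u, v) together with u ^ (size l), where F has coefficients l. *)
Fixpoint form_comp (one : T) (l u v : seq T) : seq T * seq T :=
  if l is a :: l' then
    let: (w, m) := form_comp one l' u v in
    (form_add (map (mul a) m) (form_mul v w), form_mul u m)
  else ([::], [:: one]).

Variables (A : comNzRingType) (phi : T -> A).

(* The binary form with coefficients l, in increasing powers of y; its degree
   is (size l).-1. *)
Fixpoint form (l : seq T) (x y : A) : A :=
  if l is a :: l' then phi a * x ^+ size l' + y * form l' x y else 0.

Lemma form_cons a l x y :
  form (a :: l) x y = phi a * x ^+ size l + y * form l x y.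
Proof. by []. Qed.

(** The extra factor [c] on the left raises the exponent from the degree to [size l], so the
    induction can start at the empty list. *)
Lemma form_homog l (c x y : A) :
  form l (c * x) (c * y) * c = c ^+ size l * form l x y.
Proof.
elim: l => [|a l IH] /=; first by rewrite mul0r mulr0.
rewrite mulrDl -mulrA -mulrA IH mulrDr exprMn exprS; ring.
Qed.

Hypothesis phi0 : phi zero = 0.
Hypothesis phiD : {morph phi : a b / add a b >-> a + b}.
Hypothesis phiM : {morph phi : a b / mul a b >-> a * b}.

Lemma size_form_add p q : size p = size q -> size (form_add p q) = size p.
Proof. by elim: p q => [|a p IH] [|b q] //= [/IH->]. Qed.

Lemma formD p q x y : size p = size q ->
  form (form_add p q) x y = form p x y + form q x y.
Proof.
elim: p q => [|a p IH] [|b q] //=; first by rewrite addr0.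
move=> [e]; rewrite IH // size_form_add // phiD e; ring.
Qed.

(** At x = 1 the powers of x that depend on the lengths disappear, so lists of different lengths may
    be added; cyclotomic arithmetic uses this. *)
Lemma form1D p q y : form (form_add p q) 1 y = form p 1 y + form q 1 y.
Proof.
elim: p q => [|a p IH] [|b q] //=; rewrite ?addr0 ?add0r //.
by rewrite IH phiD !expr1n; ring.
Qed.

Lemma formZ a q x y : form (map (mul a) q) x y = phi a * form q x y.
Proof.
elim: q => [|b q IH] /=; first by rewrite mulr0.
rewrite IH size_map phiM; ring.
Qed.

Lemma form_cat_zero q n x y :
  form (q ++ nseq n zero) x y = form q x y * x ^+ n.
Proof.
elim: q => [|b q IH] /=.
  by rewrite mul0r; elim: n => [|n IH] //=; rewrite IH phi0 mul0r mulr0 addr0.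
rewrite IH size_cat size_nseq exprD; ring.
Qed.

Lemma size_form_mul p q : (0 < size p)%N ->
  size (form_mul p q) = ((size p).-1 + size q)%N.
Proof.
elim: p => [|a p IH] //= _; case: p IH => [|b p] IH; first by rewrite size_map.
rewrite -/(form_mul (b :: p) q); move: (form_mul _ _) (IH isT) => r sr.
have st : size (map (mul a) q ++ nseq (size (b :: p)) zero) = size (zero :: r).
  by rewrite size_cat size_map size_nseq [RHS]/= sr addnC.
by rewrite size_form_add // st /= sr.
Qed.

Lemma formM p q x y :
  form (form_mul p q) x y = form p x y * form q x y.
Proof.
elim: p => [|a p IH] /=; first by rewrite mul0r.
case: p IH => [|b p] IH; first by rewrite formZ /= expr0; ring.
rewrite -/(form_mul (b :: p) q) -/(form (b :: p) x y).
rewrite formD; last first.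
  by rewrite size_cat size_map size_nseq [RHS]/= (@size_form_mul (b :: p)) // addnC.
rewrite form_cat_zero formZ [form (zero :: _) _ _]/= IH phi0 mul0r add0r.
move: (form (b :: p) x y) (form q x y) => P Q; ring.
Qed.

Lemma form_compE one l u v x y : phi one = 1 -> size u = 2 -> size v = 2 ->
  [/\ size (form_comp one l u v).1 = size l,
      size (form_comp one l u v).2 = (size l).+1,
      form (form_comp one l u v).2 x y = form u x y ^+ size l &
      form (form_comp one l u v).1 x y = form l (form u x y) (form v x y)].
Proof.
move=> phi1 su sv; elim: l => [|a l] /=; first by rewrite phi1; split=> //; ring.
case: (form_comp one l u v) => w m /= [sw sm em ew].
have sM : size (form_mul v w) = (size l).+1 by rewrite size_form_mul sv //= sw.
have sZ : size (map (mul a) m) = size (form_mul v w) by rewrite size_map sm sM.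
split.
- by rewrite size_form_add // size_map.
- by rewrite size_form_mul su //= sm.
- by rewrite formM em exprS.
- by rewrite formD // formZ formM em ew.
Qed.

End FormLists.

(** * Partial derivatives of integral forms *)

Section IntegralForms.
Import GRing.Theory.
Local Open Scope ring_scope.

Fixpoint form_dx (l : seq Z) : seq Z :=
  match l with
  | a :: (_ :: _) as l' => Z.mul (Z.of_nat (size l')) a :: form_dx l'
  | _ => [::]
  end.

Fixpoint form_dy (l : seq Z) : seq Z :=
  match l with
  | _ :: (_ :: _) as l' => form_add Z.add l' (Z0 :: form_dy l')
  | _ => [::]
  end.

(** Coefficients are kept in binary integers, where computation is fast, and interpreted in an
    arbitrary ring only afterwards. *)
Definition zr (A : pzRingType) (c : Z) : A := (int_of_Z c)%:~R.

Section Values.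
Variable A : comNzRingType.
Implicit Types (x y : A) (l : seq Z).

Lemma zr0 : zr A Z0 = 0. Proof. by []. Qed.
Lemma zr1 : zr A (Zpos xH) = 1. Proof. by []. Qed.
Lemma zrD : {morph zr A : a b / Z.add a b >-> a + b}.
Proof. by move=> a b; rewrite /zr [int_of_Z _]rmorphD rmorphD. Qed.
Lemma zrM : {morph zr A : a b / Z.mul a b >-> a * b}.
Proof. by move=> a b; rewrite /zr [int_of_Z _]rmorphM rmorphM. Qed.
Lemma zrN : {morph zr A : a / Z.opp a >-> - a}.
Proof. by move=> a; rewrite /zr [int_of_Z _]rmorphN rmorphN. Qed.
Lemma zr_nat n : zr A (Z.of_nat n) = n%:R.
Proof. by rewrite /zr -[Z.of_nat n]/(Z_of_int n) Z_of_intK. Qed.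

Local Notation F := (form (zr A)).

Lemma size_form_dx l : size (form_dx l) = (size l).-1.
Proof. by elim: l => [|a [|b l] IH] //; rewrite /= -/(form_dx (b :: l)) IH. Qed.

Lemma form_dxE a b l :
  form_dx [:: a, b & l] = Z.mul (Z.of_nat (size l).+1) a :: form_dx (b :: l).
Proof. by []. Qed.

Lemma form_dyE a b l :
  form_dy [:: a, b & l] = form_add Z.add (b :: l) (Z0 :: form_dy (b :: l)).
Proof. by []. Qed.

Lemma size_form_dy l : size (form_dy l) = (size l).-1.
Proof.
elim: l => [|a [|b l] IH] //.
by rewrite form_dyE size_form_add //= IH.
Qed.

Lemma form_dx_cons a b l x y :
  F (form_dx [:: a, b & l]) x y =
  (size l).+1%:R * zr A a * x ^+ size l + y * F (form_dx (b :: l)) x y.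
Proof.
by rewrite form_dxE form_cons size_form_dx zrM zr_nat.
Qed.

Lemma form_dy_cons a b l x y :
  F (form_dy [:: a, b & l]) x y =
  F (b :: l) x y + y * F (form_dy (b :: l)) x y.
Proof.
rewrite form_dyE formD //; last 2 first.
- exact: zrD.
- by have /= -> := size_form_dy (b :: l).
by congr (_ + _); rewrite form_cons zr0 mul0r add0r.
Qed.

Lemma form_euler l x y :
  x * F (form_dx l) x y + y * F (form_dy l) x y = (size l).-1%:R * F l x y.
Proof.
elim: l => [|a [|b l] IH]; rewrite ?mulr0 ?addr0 ?mul0r //.
rewrite form_dx_cons form_dy_cons (form_cons _ a).
move: IH; rewrite ![(size _).-1]/= [size (b :: l)]/= => IH.
transitivity ((size l).+1%:R * zr A a * x ^+ (size l).+1 + y * F (b :: l) x y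
   + y * (x * F (form_dx (b :: l)) x y + y * F (form_dy (b :: l)) x y)).
  by rewrite exprS; ring.
rewrite IH -natr1; ring.
Qed.

Lemma form_dxD p q x y : size p = size q ->
  F (form_dx (form_add Z.add p q)) x y = F (form_dx p) x y + F (form_dx q) x y.
Proof.
elim: p q => [|a [|b p] IH] [|c [|d q]] //; rewrite ?addr0 // => -[e].
have ebq : size (b :: p) = size (d :: q) by rewrite /= e.
move: (IH (d :: q) ebq); rewrite [form_add _ _ _ in X in _ -> X]/= [form_add _ _ _]/= => IH'.
rewrite !form_dx_cons IH' size_form_add // e zrD; ring.
Qed.

Lemma form_dyx l x y : F (form_dy (form_dx l)) x y = F (form_dx (form_dy l)) x y.
Proof.
elim: l => [|a [|b [|c l]] IH] //.
have -> : F (form_dy (form_dx [:: a, b, c & l])) x y =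
    F (form_dx [:: b, c & l]) x y + y * F (form_dy (form_dx [:: b, c & l])) x y.
  by rewrite form_dxE form_dxE form_dy_cons -form_dxE.
rewrite IH (form_dyE a) form_dxD; last first.
  exact: (congr1 S (esym (size_form_dy [:: b, c & l]))).
congr (_ + _); case: (form_dy [:: b, c & l]) (size_form_dy [:: b, c & l]) => [|u r] //.
by rewrite form_dx_cons zr0 mulr0 mul0r add0r.
Qed.

End Values.

Lemma form_deriv (K : comNzRingType) l (u v : {poly K}) :
  (form (zr {poly K}) l u v)^`() =
  form (zr {poly K}) (form_dx l) u v * u^`() + form (zr {poly K}) (form_dy l) u v * v^`().
Proof.
elim: l => [|a [|b l] IH].
- by rewrite /= deriv0 !mul0r addr0.
- rewrite /= !mul0r mulr0 !addr0 expr0 mulr1 /zr.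
  by rewrite -polyCMz; apply: derivC.
rewrite form_dx_cons form_dy_cons.
rewrite (form_cons _ a).
have za n : (zr {poly K} a * u ^+ n.+1)^`() = zr {poly K} a * (n.+1%:R * u ^+ n * u^`()).
  by rewrite derivM /zr -polyCMz derivC mul0r add0r deriv_exp -mulr_natl; ring.
rewrite derivD (za (size l)) derivM IH; ring.
Qed.
End IntegralForms.

(** * The Klein forms and their Hessians *)

Section Coefficients.
Local Open Scope Z_scope.

(** The zeros at both ends belong to the encoding: length 13 means degree 12. *)
Definition f12 : seq Z :=
  [:: 0; 1; 0; 0; 0; 0; 11; 0; 0; 0; 0; -1; 0].

Definition f20 : seq Z :=
  [:: 1; 0; 0; 0; 0; -228; 0; 0; 0; 0; 494; 0; 0; 0; 0; 228; 0; 0; 0; 0; 1].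

Definition f30 : seq Z :=
  [:: 1; 0; 0; 0; 0; 522; 0; 0; 0; 0; -10005; 0; 0; 0; 0; 0;
      0; 0; 0; 0; -10005; 0; 0; 0; 0; -522; 0; 0; 0; 0; 1].

End Coefficients.

Section KleinForms.
Import GRing.Theory Num.Theory.
Local Open Scope ring_scope.

Definition hess (A : comNzRingType) l (x y : A) : A :=
  form (zr A) (form_dx (form_dx l)) x y * form (zr A) (form_dy (form_dy l)) x y
  - form (zr A) (form_dx (form_dy l)) x y ^+ 2.

Definition hess_list l : seq Z :=
  let m := form_mul Z0 Z.add Z.mul in
  form_add Z.add (m (form_dx (form_dx l)) (form_dy (form_dy l)))
    (map (Z.mul (-1)) (m (form_dx (form_dy l)) (form_dx (form_dy l)))).

Lemma hessE (A : comNzRingType) l (x y : A) : (2 < size l)%N ->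
  form (zr A) (hess_list l) x y = hess l x y.
Proof.
move=> sl; rewrite formD; last 2 first.
- exact: zrD.
- by rewrite size_map !size_form_mul !size_form_dx ?size_form_dy //; lia.
rewrite formZ ?formM //; try by [exact: zrD | exact: zrM].
by rewrite (zrN _ 1) zr1 mulN1r /hess expr2.
Qed.

(** The Hessian is a covariant, here an icosahedral invariant of degree 36. The constant 20 * 19 *
    20 * (-228) is read off at x^33 y^3; only its being non-zero matters later. *)
Lemma hess_f20 (A : comNzRingType) : exists2 c, c <> Z0 &
  forall x y : A, hess f20 x y = zr A c * form (zr A) f12 x y ^+ 3.
Proof.
exists (Z.opp 1732800) => // x y; rewrite -hessE //.
have -> : hess_list f20 = map (Z.mul (-1732800))
    (form_mul Z0 Z.add Z.mul f12 (form_mul Z0 Z.add Z.mul f12 f12)).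
  by vm_compute.
by rewrite formZ ?formM //; try by [exact: zrD | exact: zrM].
Qed.

Lemma hess_f30 (A : comNzRingType) : exists2 c, c <> Z0 &
  forall x y : A, hess f30 x y =
    zr A c * (form (zr A) f12 x y ^+ 3 * form (zr A) f20 x y).
Proof.
exists (Z.opp (Z.opp 9082800)) => // x y; rewrite -hessE //.
have -> : hess_list f30 = map (Z.mul 9082800)
    (form_mul Z0 Z.add Z.mul
       (form_mul Z0 Z.add Z.mul f12 (form_mul Z0 Z.add Z.mul f12 f12)) f20).
  by vm_compute.
by rewrite formZ ?formM //; try by [exact: zrD | exact: zrM].
Qed.

End KleinForms.

(** * Forms along lines and linear substitutions *)

Section Lines.
Import GRing.Theory Num.Theory.
Local Open Scope ring_scope.
Variable K : numFieldType.
Local Notation P := {poly K}.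

Lemma zr_neq0 c : c <> Z0 -> zr K c != 0.
Proof. by move=> c0; rewrite /zr intr_eq0; apply/eqP => e; apply: c0; rewrite -[c]int_of_ZK e. Qed.

Lemma zrC c : zr P c = (zr K c)%:P.
Proof. by rewrite /zr polyCMz. Qed.

Lemma horner_form l (u v : P) t :
  (form (zr P) l u v).[t] = form (zr K) l u.[t] v.[t].
Proof. by elim: l => [|a l IH] /=; rewrite ?horner0 // !hornerE zrC IH !hornerE. Qed.

Lemma line_deriv l (p1 p2 q1 q2 : K) :
  let u := p1%:P + q1 *: 'X in let v := p2%:P + q2 *: 'X in
  (form (zr P) l u v)^`() =
  form (zr P) (form_dx l) u v * q1%:P + form (zr P) (form_dy l) u v * q2%:P.
Proof.
move=> u v.
have d p q : (p%:P + q *: 'X : P)^`() = q%:P.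
  by rewrite derivD derivC derivZ derivX add0r alg_polyC.
by rewrite form_deriv !d.
Qed.

Lemma line_deriv2 l (p1 p2 q1 q2 : K) :
  let u := p1%:P + q1 *: 'X in let v := p2%:P + q2 *: 'X in
  (form (zr P) l u v)^`()^`() =
  form (zr P) (form_dx (form_dx l)) u v * q1%:P ^+ 2 +
  form (zr P) (form_dx (form_dy l)) u v * (2 * q1%:P * q2%:P) +
  form (zr P) (form_dy (form_dy l)) u v * q2%:P ^+ 2.
Proof.
move=> u v; rewrite line_deriv derivD !derivM !derivC !line_deriv form_dyx.
by rewrite -/u -/v; ring.
Qed.

(** Euler's identity eliminates the partial derivatives in favour of derivatives along the line, so
    the Hessian there depends only on the restriction [g]. As linear substitutions map lines to
    lines, its covariance reduces to polynomials in one variable. *)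
Lemma line_hess l (p1 p2 q1 q2 : K) :
  let u := p1%:P + q1 *: 'X in let v := p2%:P + q2 *: 'X in
  let g := form (zr P) l u v in let n := (size l).-1 in
  (p1 * q2 - p2 * q1) ^+ 2 *: hess l u v =
  n%:R * (n.-1)%:R * g * g^`()^`() - (n.-1%:R * g^`()) ^+ 2.
Proof.
move=> u v g n; rewrite /hess.
have e1 := form_euler l u v.
have e2 := form_euler (form_dx l) u v.
have e3 := form_euler (form_dy l) u v.
have eg := line_deriv l p1 p2 q1 q2.
have egg := line_deriv2 l p1 p2 q1 q2.
cbv zeta in eg, egg; rewrite -/u -/v -/g in eg egg.
have ed : (p1 * q2 - p2 * q1)%:P = u * q2%:P - v * q1%:P.
  by rewrite /u /v polyCB !polyCM -!mul_polyC; ring.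
rewrite -mul_polyC polyC_exp ed -/n in e1 *.
rewrite size_form_dx -/n form_dyx in e2; rewrite size_form_dy -/n in e3.
have e4 : n%:R * n.-1%:R * g = u * (n.-1%:R * form (zr P) (form_dx l) u v)
    + v * (n.-1%:R * form (zr P) (form_dy l) u v).
  by rewrite -mulrA mulrCA -e1; ring.
rewrite egg e4 eg -e2 -e3 [n.-1%:R * _]mulrDr ![n.-1%:R * (_ * _)]mulrA -e2 -e3.
ring.
Qed.

Lemma horner0_line (p q : K) : (p%:P + q *: 'X).[0] = p.
Proof. by rewrite hornerD hornerC hornerZ hornerX mulr0 addr0. Qed.

Definition preserves (l : seq Z) (a b c d : K) :=
  forall x y, form (zr K) l (a * x + b * y) (c * x + d * y) = form (zr K) l x y.

Lemma poly_ext (p q : P) : (forall t, p.[t] = q.[t]) -> p = q.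
Proof.
move=> h; apply/eqP; rewrite -subr_eq0; apply/negPn/negP => n0.
set s := [seq i%:R : K | i <- iota 0 (size (p - q))].
have := max_poly_roots (rs := s) n0; rewrite size_map size_iota ltnn.
move=> H; suff: false by []; apply: H.
  by apply/allP => x _; rewrite rootE !hornerE h subrr.
by rewrite map_inj_uniq ?iota_uniq // => i j /eqP; rewrite eqr_nat => /eqP.
Qed.

Lemma preserves_line l a b c d : preserves l a b c d ->
  form (zr P) l (a%:P + b *: 'X) (c%:P + d *: 'X) = form (zr P) l 1 'X.
Proof.
move=> h; apply: poly_ext => t; rewrite !horner_form !hornerE.
by have := h 1 t; rewrite !mulr1.
Qed.

Lemma preserves_hess l a b c d : preserves l a b c d ->
  (a * d - c * b) ^+ 2 *: hess l (a%:P + b *: 'X) (c%:P + d *: 'X) =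
  hess l (1 : P) 'X.
Proof.
move=> h; have := @line_hess l a c b d; cbv zeta; rewrite (preserves_line h) => ->.
have := @line_hess l 1 0 0 1; cbv zeta.
by rewrite polyC0 polyC1 scale0r scale1r !addr0 add0r mulr1 mulr0 subr0 expr1n scale1r.
Qed.

Lemma f12_at_infinity : form (zr P) f12 1 'X = 'X * form (zr P) (behead f12) 1 'X.
Proof. by rewrite {1}/f12 form_cons zr0 mul0r add0r. Qed.

Lemma preserves_f12_root a b c d : preserves f12 a b c d ->
  form (zr K) f12 a c = 0.
Proof.
move=> h; have := h 1 0; rewrite !mulr1 !mulr0 !addr0 => ->.
by rewrite /f12 /= zr0 !mul0r !addr0.
Qed.

Lemma preserves_f20_root a b c d : a * d - c * b != 0 -> preserves f20 a b c d ->
  form (zr K) f12 a c = 0.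
Proof.
have [k k0 hk] := hess_f20 P.
move=> nd /preserves_hess; rewrite !hk f12_at_infinity.
move/(congr1 (horner^~ 0)); have hM (p q : P) t : (p * q ^+ 3).[t] = p.[t] * q.[t] ^+ 3.
  by rewrite hornerM horner_exp.
rewrite hornerZ !hM horner_form !horner0_line zrC hornerC [('X * _).[_]]hornerM hornerX mul0r expr0n mulr0.
move/eqP; rewrite mulf_eq0 expf_eq0 (negPf nd) /=.
by rewrite mulf_eq0 (negPf (zr_neq0 k0)) expf_eq0 => /eqP.
Qed.

(** The Hessian alone leaves open that (a, c) is a root of [f20]. If it is not a root of [f12], the
    triple zero of the Hessian at (1, 0) passes to [f20] along the image line; a multiple zero of
    [f20] is a zero of its Hessian, hence of [f12] after all. *)
Lemma preserves_f30_root a b c d : a * d - c * b != 0 -> preserves f30 a b c d ->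
  form (zr K) f12 a c = 0.
Proof.
have [k k0 hk] := hess_f30 P; have [m m0 hm] := hess_f20 P.
move=> nd /preserves_hess; rewrite !hk f12_at_infinity.
set u := a%:P + _; set v := c%:P + _.
set f := form _ f12 u v; set h := form _ f20 u v => e.
apply/eqP/negPn/negP => f0.
have rf : ~~ root f 0 by rewrite rootE /f horner_form !horner0_line.
have : 'X ^+ 3 %| h.
  rewrite -(@Gauss_dvdpr _ _ (f ^+ 3)); last first.
    apply: coprimep_expl; apply: coprimep_expr.
    by rewrite coprimep_sym -['X]subr0 -polyC0 coprimep_XsubC.
  have : 'X ^+ 3 %| (a * d - c * b) ^+ 2 *: (zr P k * (f ^+ 3 * h)).
    by rewrite e exprMn -mulrA; apply/dvdp_mull/dvdp_mulr.
  by rewrite zrC mul_polyC !dvdpZr ?expf_neq0 // zr_neq0.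
case/dvdpP => r hr.
have := @line_hess f20 a c b d; cbv zeta; rewrite -/u -/v -/h hm -/f.
have dh : 'X %| h by rewrite hr exprSr mulrA dvdp_mulIr.
have dh' : 'X %| h^`().
  rewrite hr exprSr mulrA derivM derivX mulr1.
  by apply: dvdp_add; [apply: dvdp_mulIr | rewrite exprSr mulrA dvdp_mulIr].
move=> e'.
have : 'X %| (a * d - c * b) ^+ 2 *: (zr P m * f ^+ 3).
  by rewrite e'; apply: dvdp_sub; [apply/dvdp_mulr/dvdp_mull | apply/dvdp_exp/dvdp_mull].
rewrite zrC mul_polyC !dvdpZr ?expf_neq0 // ?zr_neq0 //.
by rewrite -['X]subr0 -polyC0 dvdp_XsubCl rootE horner_exp expf_eq0 -rootE (negPf rf).
Qed.

Lemma form_y0 l (x : K) :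
  form (zr K) l x 0 = zr K (head Z0 l) * x ^+ (size l).-1.
Proof. by case: l => [|a l] /=; rewrite mul0r ?addr0. Qed.

Lemma coef_form l (a d : K) k : (k < size l)%N ->
  (form (zr P) l a%:P (d *: 'X))`_k =
  zr K (nth Z0 l k) * a ^+ ((size l).-1 - k) * d ^+ k.
Proof.
elim: l k => [|c l IH] [|k] // kl; rewrite form_cons coefD -scalerAl coefZ coefXM /=.
  by rewrite mulr0 addr0 zrC -polyC_exp -polyCM coefC subn0 expr0 mulr1.
rewrite zrC -polyC_exp -polyCM coefC add0r IH // exprS subnS predn_sub; ring.
Qed.

Lemma preserves_coef l a d k : preserves l a 0 0 d -> (k < size l)%N ->
  nth Z0 l k <> Z0 -> a ^+ ((size l).-1 - k) * d ^+ k = 1.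
Proof.
move=> /preserves_line h kl nz; have := coef_form a d kl.
have := coef_form 1 1 kl; rewrite !expr1n !mulr1 polyC1 scale1r => e1.
move: h; rewrite scale0r addr0 polyC0 add0r => ->; rewrite e1 -mulrA.
by rewrite -[LHS]mulr1 => /(mulfI (zr_neq0 nz)) /esym.
Qed.

Lemma preserves_triangular l a b d : preserves l a b 0 d ->
  zr K (head Z0 (form_dx l)) * a ^+ (size (form_dx l)).-1 * b =
  zr K (head Z0 (form_dy l)) * (1 - a ^+ (size (form_dy l)).-1 * d).
Proof.
move=> /preserves_line h; have := line_deriv l a 0 b d; cbv zeta; rewrite h.
have := line_deriv l 1 0 0 1; cbv zeta.
rewrite scale0r addr0 polyC1 polyC0 scale1r !add0r mulr0 mulr1 add0r => ->.
move/(congr1 (horner^~ 0)); rewrite !hornerE !horner_form !hornerE !form_y0 => /eqP.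
rewrite -subr_eq0 => /eqP e; apply/eqP; rewrite -subr_eq0 -oppr_eq0 -e expr1n; apply/eqP; ring.
Qed.

(** For [f12] the first-order condition says nothing about [b], because F_x vanishes at (1, 0). At
    second order only the mixed derivative survives and forces b = 0. *)
Lemma preserves_triangular2 l a b d : preserves l a b 0 d ->
  zr K (head Z0 (form_dx (form_dx l))) * a ^+ (size (form_dx (form_dx l))).-1 * b ^+ 2 +
  zr K (head Z0 (form_dx (form_dy l))) * a ^+ (size (form_dx (form_dy l))).-1 * (2 * b * d) +
  zr K (head Z0 (form_dy (form_dy l))) * a ^+ (size (form_dy (form_dy l))).-1 * d ^+ 2 =
  zr K (head Z0 (form_dy (form_dy l))).
Proof.
move=> /preserves_line h; have := line_deriv2 l a 0 b d; cbv zeta; rewrite h.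
have := line_deriv2 l 1 0 0 1; cbv zeta.
rewrite scale0r addr0 polyC1 polyC0 scale1r !add0r expr0n expr1n /= !mulr0 mul0r !mulr0 mulr1 !add0r => ->.
move/(congr1 (horner^~ 0)); rewrite !hornerE !horner_form !hornerE !form_y0 expr1n mulr1.
by [].
Qed.

Lemma preserves_f20_diagonal a b d : a != 0 -> d != 0 -> preserves f20 a b 0 d ->
  b = 0 /\ d ^+ 5 = a ^+ 5.
Proof.
move=> a0 d0 h.
have b0 : b = 0.
  apply/eqP; have /eqP := preserves_triangular h.
  rewrite [head _ (form_dy _)]/= zr0 mul0r mulf_eq0 mulf_eq0 expf_eq0 (negPf a0) andbF orbF.
  by rewrite (negPf (@zr_neq0 _ _)).
split=> //; rewrite b0 in h.
apply: (@mulfI _ (a ^+ 15)); first by rewrite expf_neq0.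
have /= -> := preserves_coef (k := 5) h isT; last by [].
by have /= <- := preserves_coef (k := 0) h isT; rewrite // mulr1 -exprD.
Qed.

Lemma preserves_f30_diagonal a b d : a != 0 -> d != 0 -> preserves f30 a b 0 d ->
  b = 0 /\ d ^+ 5 = a ^+ 5.
Proof.
move=> a0 d0 h.
have b0 : b = 0.
  apply/eqP; have /eqP := preserves_triangular h.
  rewrite [head _ (form_dy _)]/= zr0 mul0r mulf_eq0 mulf_eq0 expf_eq0 (negPf a0) andbF orbF.
  by rewrite (negPf (@zr_neq0 _ _)).
split=> //; rewrite b0 in h.
apply: (@mulfI _ (a ^+ 25)); first by rewrite expf_neq0.
have /= -> := preserves_coef (k := 5) h isT; last by [].
by have /= <- := preserves_coef (k := 0) h isT; rewrite // mulr1 -exprD.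
Qed.

Lemma preserves_f12_diagonal a b d : a != 0 -> d != 0 -> preserves f12 a b 0 d ->
  b = 0 /\ d ^+ 5 = a ^+ 5.
Proof.
move=> a0 d0 h.
have b0 : b = 0.
  apply/eqP; have /eqP := preserves_triangular2 h.
  have n2 : (2 == 0 :> K) = false by rewrite pnatr_eq0.
  rewrite [head _ (form_dx (form_dx _))]/= [head _ (form_dy (form_dy _))]/= zr0 !mul0r add0r addr0.
  rewrite mulf_eq0 mulf_eq0 expf_eq0 (negPf a0) andbF orbF mulf_eq0 (negPf d0).
  rewrite orbF mulf_eq0 n2 orFb.
  by rewrite (negPf (@zr_neq0 _ _)).
split=> //; rewrite b0 in h.
apply: (@mulfI _ (a ^+ 6 * d)); first by rewrite mulf_neq0 ?expf_neq0.
have := preserves_coef (k := 6) h isT; have := preserves_coef (k := 1) h isT.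
move=> /= e1 e2; transitivity (a ^+ 6 * d ^+ 6); first by ring.
rewrite e2 //; transitivity (a ^+ 11 * d ^+ 1); first by rewrite e1.
ring.
Qed.

End Lines.

(** * Arithmetic in Z[z] and the Weil matrices *)

(* A list of integers stands for the element of Z[z], z ^ 5 = 1, with these
   coefficients on the powers of z. *)
Section CyclotomicIntegers.

(** Lists of length at most 5 have a product of length at most 9, so one fold by z^5 = 1 brings it
    back to length 5. *)
Definition cyc_mul (p q : seq Z) : seq Z :=
  let l := form_mul Z0 Z.add Z.mul p q in
  form_add Z.add (take 5 l) (drop 5 l).

(** Since 1 + z + z^2 + z^3 + z^4 = 0, a difference with five equal entries has value zero; adding
    [nseq 5 Z0] pads short lists. *)
Definition cyc_eq (p q : seq Z) : bool :=
  let d := form_add Z.add (form_add Z.add p (map (Z.mul (-1)) q)) (nseq 5 Z0) in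
  (size d == 5) && all (Z.eqb (head Z0 d)) d.

Definition cyc_mono (n : nat) : seq Z := rcons (nseq n Z0) (Zpos 1).

(** The negative of the quadratic Gauss sum modulo 5. *)
Definition cyc_sqrt5 : seq Z := [:: Z0; Z.opp 1; Zpos 1; Zpos 1; Z.opp 1].

Definition legendre5 (a : nat) : Z := if (a == 1) || (a == 4) then Zpos 1 else Z.opp 1.

(* Entries of the Weil representation of SL(2,5) on odd functions on F_5, times
   the square root of 5, in the basis d_1 - d_4, d_3 - d_2; here x, y are 1 or 2. *)
Definition weil_entry (a b c d x y : nat) : seq Z :=
  let sg := if x == y then Zpos 1 else Z.opp 1 in
  let e (t : nat) := cyc_mono (((a * x ^ 2 + t * x * y + d * y ^ 2) * (3 * c ^ 3)) %% 5) in
  if c == 0 then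
    let m := cyc_mul cyc_sqrt5 (cyc_mono ((3 * a * b * x ^ 2) %% 5)) in
    if (a * x) %% 5 == y then map (Z.mul (Z.mul sg (legendre5 a))) m
    else if (a * x + y) %% 5 == 0 then map (Z.mul (Z.opp (Z.mul sg (legendre5 a)))) m
    else [::]
  else map (Z.mul (Z.mul sg (legendre5 c))) (form_add Z.add (e 3) (map (Z.mul (-1)) (e 2))).

Definition weil_mul_check (a b c d a' b' c' d' : nat) : bool :=
  let P := weil_entry a b c d in let Q := weil_entry a' b' c' d' in
  let R := weil_entry ((a * a' + b * c') %% 5) ((a * b' + b * d') %% 5)
                      ((c * a' + d * c') %% 5) ((c * b' + d * d') %% 5) in
  all (fun x => all (fun y =>
    cyc_eq (form_add Z.add (cyc_mul (P x 1) (Q 1 y)) (cyc_mul (P x 2) (Q 2 y)))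
           (cyc_mul cyc_sqrt5 (R x y))) [:: 1; 2]) [:: 1; 2].

(** The left factor is fixed and the right one runs over SL(2,5), with 4 standing for -1. It
    suffices to run this for generators on the left. *)
Definition weil_mul_check_all (a b c d : nat) : bool :=
  all (fun a' => all (fun b' => all (fun c' => all (fun d' =>
    ((a' * d' + 4 * (b' * c')) %% 5 == 1) ==> weil_mul_check a b c d a' b' c' d')
   (iota 0 5)) (iota 0 5)) (iota 0 5)) (iota 0 5).

Lemma weil_mul_check_u : weil_mul_check_all 1 1 0 1.
Proof. by vm_compute. Qed.

Lemma weil_mul_check_w : weil_mul_check_all 0 1 4 0.
Proof. by vm_compute. Qed.

(** The entries carry a factor [sqrt5], so for a form of degree d invariance holds up to
    [sqrt5 ^ d], the scalar [s]. *)
Definition weil_invariant_check (l : seq Z) (a b c d : nat) : bool :=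
  let P := weil_entry a b c d in
  let s := iter (size l).-1 (cyc_mul cyc_sqrt5) [:: Zpos 1] in
  let F := map (fun c => [:: c]) l in
  let G := (form_comp [::] (form_add Z.add) cyc_mul [:: Zpos 1] F
             [:: P 1 1; P 1 2] [:: P 2 1; P 2 2]).1 in
  all2 cyc_eq G (map (cyc_mul s) F).

Lemma weil_invariant_u : all (fun l => weil_invariant_check l 1 1 0 1) [:: f12; f20; f30].
Proof. by vm_compute. Qed.

Lemma weil_invariant_w : all (fun l => weil_invariant_check l 0 1 4 0) [:: f12; f20; f30].
Proof. by vm_compute. Qed.

End CyclotomicIntegers.

(** * Evaluation at a primitive fifth root of unity *)

Section CyclotomicValues.
Import GRing.Theory Num.Theory.
Local Open Scope ring_scope.
Variables (K : numFieldType) (z : K).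
Hypothesis z_prim : 5.-primitive_root z.

Definition cyc (l : seq Z) : K := form (zr K) l 1 z.

Lemma cycD : {morph cyc : p q / form_add Z.add p q >-> p + q}.
Proof. by move=> p q; apply/form1D/zrD. Qed.

Lemma cycZ c l : cyc (map (Z.mul c) l) = zr K c * cyc l.
Proof. by apply/formZ/zrM. Qed.

Lemma cyc_cat p q : cyc (p ++ q) = cyc p + z ^+ size p * cyc q.
Proof.
elim: p => [|a p IH]; rewrite /cyc /= ?expr1n; first by rewrite add0r mul1r.
by move: IH; rewrite /cyc => ->; rewrite exprS; ring.
Qed.

Lemma cycM : {morph cyc : p q / cyc_mul p q >-> p * q}.
Proof.
move=> p q; rewrite /cyc_mul cycD.
transitivity (cyc (form_mul Z0 Z.add Z.mul p q)); last first.
  by apply: formM => //; [apply: zrD | apply: zrM].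
move: (form_mul _ _ _ _ _) => l; rewrite -[in RHS](cat_take_drop 5 l) cyc_cat.
rewrite size_take; case: ltnP => hl; first by rewrite (prim_expr_order z_prim) mul1r.
by rewrite drop_oversize // /cyc /= mulr0.
Qed.

Lemma cyc0 : cyc [::] = 0. Proof. by []. Qed.

Lemma cyc_nseq0 n : cyc (nseq n Z0) = 0.
Proof. by elim: n => [|n IH] //; rewrite /cyc /= [form _ _ _ _]IH zr0 mul0r mulr0 addr0. Qed.

Lemma cyc_monoE n : cyc (cyc_mono n) = z ^+ n.
Proof.
rewrite /cyc_mono -cats1 cyc_cat cyc_nseq0 size_nseq add0r.
by rewrite /cyc /= zr1 expr0 mulr0 !mulr1 addr0 mulr1.
Qed.

Lemma sum_powers_z : 1 + z + z ^+ 2 + z ^+ 3 + z ^+ 4 = 0.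
Proof.
apply: (@mulfI _ (z - 1)).
  by rewrite subr_eq0; have := eq_prim_root_expr z_prim 1 0; rewrite expr1 expr0 => ->.
by rewrite mulr0; transitivity (z ^+ 5 - 1); [ring | rewrite (prim_expr_order z_prim) subrr].
Qed.

Lemma cyc_eqP p q : cyc_eq p q -> cyc p = cyc q.
Proof.
rewrite /cyc_eq; set d := form_add _ _ _ => /andP[/eqP sd ad].
have : cyc d = 0.
  case: (d) sd ad => [|a [|b [|c [|e [|f [|]]]]]] //= _ /and5P[_ /Z.eqb_eq<- /Z.eqb_eq<- /Z.eqb_eq<-].
  rewrite andbT => /Z.eqb_eq<-.
  rewrite /cyc /= !expr1n; transitivity (zr K a * (1 + z + z ^+ 2 + z ^+ 3 + z ^+ 4)); first by ring.
  by rewrite sum_powers_z mulr0.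
rewrite /d !cycD cyc_nseq0 addr0 cycZ (zrN _ 1) zr1 mulN1r => /eqP.
by rewrite subr_eq0 => /eqP.
Qed.

Definition sqrt5 : K := cyc cyc_sqrt5.

Lemma sqrt5_sqr : sqrt5 ^+ 2 = 5.
Proof.
rewrite expr2 -cycM; transitivity (cyc [:: Zpos 5]).
  by apply: cyc_eqP; vm_compute.
rewrite /cyc /= mulr0 addr0 mulr1 /zr.
by have -> : int_of_Z 5 = 5 by [].
Qed.

Lemma sqrt5_neq0 : sqrt5 != 0.
Proof.
apply/eqP => e; have := sqrt5_sqr; rewrite e expr0n => /eqP.
by rewrite eq_sym pnatr_eq0.
Qed.

Definition weil (g : 'M['F_5]_2) : 'M[K]_2 :=
  \matrix_(i, j) (cyc (weil_entry (g 0 0) (g 0 1) (g 1 0) (g 1 1) i.+1 j.+1) / sqrt5).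

Lemma weilE g i j : weil g i j =
  cyc (weil_entry (g 0 0) (g 0 1) (g 1 0) (g 1 1) i.+1 j.+1) / sqrt5.
Proof. exact: mxE. Qed.

Lemma matrix2P (R : Type) (A B : 'M[R]_2) :
  A 0 0 = B 0 0 -> A 0 1 = B 0 1 -> A 1 0 = B 1 0 -> A 1 1 = B 1 1 -> A = B.
Proof.
move=> e1 e2 e3 e4; apply/matrixP => i j.
have ord2 (k : 'I_2) : k = 0 \/ k = 1.
  by case: k => [[|[|[]]] kl] //; [left|right]; apply: val_inj.
by case: (ord2 i) => ->; case: (ord2 j) => ->.
Qed.

Lemma mulmx2E (R : pzRingType) (A B : 'M[R]_2) i j :
  (A *m B) i j = A i 0 * B 0 j + A i 1 * B 1 j.
Proof.
rewrite mxE !big_ord_recl big_ord0 addr0.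
by congr (_ * B _ j + A _ _ * B _ j); apply: val_inj.
Qed.

Lemma det2 (R : comNzRingType) (A : 'M[R]_2) :
  \det A = A 0 0 * A 1 1 - A 0 1 * A 1 0.
Proof.
rewrite (expand_det_row _ 0) !big_ord_recl big_ord0 addr0 /cofactor !det_mx11.
rewrite !mxE /= expr0 mul1r expr1 mulN1r mulrN.
by congr (_ * A _ _ - A _ _ * A _ _); apply: val_inj.
Qed.

Lemma natr_F5 (x : 'F_5) : (x : nat)%:R = x.
Proof. exact: natr_Zp. Qed.

Lemma weil_mul (g h : 'M['F_5]_2) :
  weil_mul_check_all (g 0 0) (g 0 1) (g 1 0) (g 1 1) ->
  \det h = 1 -> weil (g *m h) = weil g *m weil h.
Proof.
move=> ck dh.
have mI (x : 'F_5) : nat_of_ord x \in iota 0 5 by rewrite mem_iota; apply: (ltn_ord x).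
move: ck => /allP/(_ _ (mI (h 0 0)))/allP/(_ _ (mI (h 0 1))).
move=> /allP/(_ _ (mI (h 1 0)))/allP/(_ _ (mI (h 1 1)))/implyP.
have -> : modn (addn (muln (h 0 0) (h 1 1)) (muln 4 (muln (h 0 1) (h 1 0)))) 5 == 1%N.
  rewrite -(@val_Fp_nat 5) // natrD !natrM !natr_F5.
  have -> : 4 = -1 :> 'F_5 by apply: val_inj.
  by rewrite mulN1r -det2 dh.
move=> /(_ isT).
have vE (a b c d : 'F_5) : ((a * b + c * d) %% 5)%N = (a * b + c * d : 'F_5).
  by rewrite -(@val_Fp_nat 5) // natrD !natrM !natr_F5.
rewrite /weil_mul_check !vE -!mulmx2E => ck.
have E (x y : nat) : x \in [:: 1; 2]%N -> y \in [:: 1; 2]%N ->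
   cyc (weil_entry ((g *m h) 0 0) ((g *m h) 0 1) ((g *m h) 1 0) ((g *m h) 1 1) x y) / sqrt5 =
   (cyc (weil_entry (g 0 0) (g 0 1) (g 1 0) (g 1 1) x 1) / sqrt5) *
   (cyc (weil_entry (h 0 0) (h 0 1) (h 1 0) (h 1 1) 1 y) / sqrt5) +
   (cyc (weil_entry (g 0 0) (g 0 1) (g 1 0) (g 1 1) x 2) / sqrt5) *
   (cyc (weil_entry (h 0 0) (h 0 1) (h 1 0) (h 1 1) 2 y) / sqrt5).
  move=> xI yI; have /cyc_eqP := allP (allP ck x xI) y yI.
  rewrite cycD !cycM -/sqrt5 => e.
  apply: (@mulfI _ (sqrt5 * sqrt5)); first by rewrite mulf_neq0 ?sqrt5_neq0.
  transitivity (sqrt5 * cyc (weil_entry ((g *m h) 0 0) ((g *m h) 0 1) ((g *m h) 1 0) ((g *m h) 1 1) x y)).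
    by rewrite mulrA mulrAC mulrK ?unitfE ?sqrt5_neq0.
  rewrite -e; field; exact: sqrt5_neq0.
by apply: matrix2P; rewrite [RHS]mulmx2E !weilE; apply: E.
Qed.

Definition preserved (l : seq Z) (B : 'M[K]_2) :=
  preserves l (B 0 0) (B 0 1) (B 1 0) (B 1 1).

Lemma preservedM l (B C : 'M[K]_2) :
  preserved l B -> preserved l C -> preserved l (B *m C).
Proof.
move=> hB hC x y; rewrite -[RHS]hC -[RHS]hB !mulmx2E.
by congr (form _ _ _ _); ring.
Qed.

Lemma form_cyc1 l x y :
  form cyc (map (fun c => [:: c]) l) x y = form (zr K) l x y.
Proof.
elim: l => [|a l IH] //=; rewrite IH size_map; congr (_ * _ + _).
by rewrite /cyc /= expr0 mulr0 addr0 mulr1.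
Qed.

Lemma form_cyc_eq p q x y : all2 cyc_eq p q -> form cyc p x y = form cyc q x y.
Proof.
elim: p q => [|a p IH] [|b q] //= /andP[/cyc_eqP-> h]; rewrite (IH _ h).
suff -> : size p = size q by [].
by elim: p q h {IH} => [|c p IH] [|d q] //= /andP[_ /IH->].
Qed.

Lemma weil_preserved l (g : 'M['F_5]_2) : (0 < size l)%N ->
  weil_invariant_check l (g 0 0) (g 0 1) (g 1 0) (g 1 1) ->
  preserved l (weil g).
Proof.
move=> sl ck x y; rewrite !mxE.
set P := weil_entry _ _ _ _ in ck *.
have cyc1 : cyc [:: Zpos 1] = 1 by rewrite /cyc /= zr1 mulr0 addr0 mulr1.
have cycI n : cyc (iter n (cyc_mul cyc_sqrt5) [:: Zpos 1]) = sqrt5 ^+ n.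
  by elim: n => [|n IH] //; rewrite iterS cycM IH exprS.
have F1 : form cyc (map (fun c => [:: c]) l) =2 form (zr K) l.
  exact: form_cyc1.
have := form_cyc_eq x y ck.
have [_ _ _ ->] := @form_compE _ [::] (form_add Z.add) cyc_mul K cyc cyc0 cycD cycM [:: Zpos 1]
  (map (fun c => [:: c]) l) [:: P 1%N 1%N; P 1%N 2%N] [:: P 2%N 1%N; P 2%N 2%N] x y cyc1 erefl erefl.
rewrite (formZ cycM) cycI !form_cyc1 => e.
apply: (@mulfI _ (sqrt5 ^+ (size l).-1)); first by rewrite expf_neq0 ?sqrt5_neq0.
(* The additional [sqrt5] is the extra factor that [form_homog] requires. *)
rewrite -e; apply: (@mulIf _ sqrt5); first exact: sqrt5_neq0.
rewrite mulrAC -exprSr prednK // -form_homog.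
congr (form _ _ _ _ * _) => /=; rewrite !expr0 !mulr0 !addr0 expr1.
all: field; exact: sqrt5_neq0.
Qed.

End CyclotomicValues.

(** * Generators of SL(2,5) *)

Section SpecialLinearGenerators.
Import GRing.Theory.
Local Open Scope ring_scope.

Definition mx2 (R : pzRingType) (a b c d : R) : 'M[R]_2 :=
  \matrix_(i, j) if i == 0 then (if j == 0 then a else b)
                 else (if j == 0 then c else d).

Lemma mx2E (R : pzRingType) (a b c d : R) :
  ((mx2 a b c d 0 0 = a) * (mx2 a b c d 0 1 = b)) *
  ((mx2 a b c d 1 0 = c) * (mx2 a b c d 1 1 = d)).
Proof. by rewrite !mxE. Qed.

Lemma mx2_eta (R : pzRingType) (A : 'M[R]_2) :
  A = mx2 (A 0 0) (A 0 1) (A 1 0) (A 1 1).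
Proof. by apply: matrix2P; rewrite mx2E. Qed.

Lemma mx2M (R : pzRingType) (a b c d a' b' c' d' : R) :
  mx2 a b c d *m mx2 a' b' c' d' =
  mx2 (a * a' + b * c') (a * b' + b * d') (c * a' + d * c') (c * b' + d * d').
Proof. by apply: matrix2P; rewrite mulmx2E !mx2E. Qed.

Lemma det_mx2 (R : comNzRingType) (a b c d : R) :
  \det (mx2 a b c d) = a * d - b * c.
Proof. by rewrite det2 !mx2E. Qed.

(* Every element is a product of transvections. *)
Lemma SL2_ind (P : 'M['F_5]_2 -> Prop) :
  P (mx2 1 1 0 1) -> P (mx2 0 1 (-1) 0) ->
  (forall g h, \det g = 1 -> \det h = 1 -> P g -> P h -> P (g *m h)) ->
  forall g, \det g = 1 -> P g.
Proof.
move=> Pu Pw PM.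
have dw : \det (mx2 0 1 (-1) 0 : 'M['F_5]_2) = 1 by rewrite det_mx2; ring.
have du b : \det (mx2 1 b 0 1 : 'M['F_5]_2) = 1 by rewrite det_mx2; ring.
have dl c : \det (mx2 1 0 c 1 : 'M['F_5]_2) = 1 by rewrite det_mx2; ring.
have Pun n : P (mx2 1 n.+1%:R 0 1).
  elim: n => [|n IH] //.
  have := PM _ _ (du 1) (du _) Pu IH; rewrite mx2M; congr (P (mx2 _ _ _ _)); last ring.
  - ring.
  - by rewrite -[in RHS]natr1; ring.
  - ring.
have PU b : P (mx2 1 b 0 1).
  (* [P] is closed under products but not given at the identity, so b is represented by a positive
     integer, shifted by 5. *)
  have -> : b = (nat_of_ord b + 4)%N.+1%:R.
    have e5 : 5%:R = 0 :> 'F_5 by apply: val_inj.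
    by rewrite -addnS natrD natr_F5 e5 addr0.
  exact: Pun.
(* The cube of w is its inverse, so multiplying three times by w on the right completes the
   conjugation of an upper transvection into a lower one. *)
have PL c : P (mx2 1 0 c 1).
  have d2 := du (- c).
  have P1 := PM _ _ dw (du (- c)) Pw (PU _).
  have P2 := PM _ _ _ dw P1 Pw.
  have P3 := PM _ _ _ dw (P2 _) Pw.
  have P4 := PM _ _ _ dw (P3 _ _) Pw.
  move: P4; rewrite !det_mulmx !dw !du !mulr1 => /(_ erefl erefl erefl).
  by rewrite !mx2M; congr (P (mx2 _ _ _ _)); ring.
have Pc a b c d : c != 0 -> a * d - b * c = 1 -> P (mx2 a b c d).
  move=> c0 e.
  (* For c != 0 the matrix is upper, lower, upper unitriangular with parameters (a - 1) / c, c and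
     (d - 1) / c. *)
  have := PM _ _ _ (du ((d - 1) / c)) (PM _ _ (du ((a - 1) / c)) (dl c) (PU _) (PL _)) (PU _).
  rewrite det_mulmx du dl mulr1 => /(_ erefl); rewrite !mx2M.
  congr (P (mx2 _ _ _ _)).
  - by field.
  - have -> : b = (a * d - 1) / c by rewrite -e; field.
    by field.
  - ring.
  - by field.
move=> g; rewrite (mx2_eta g) det_mx2; move: (g 0 0) (g 0 1) (g 1 0) (g 1 1) => a b c d e.
have [c0|] := eqVneq c 0; last by move=> c0; apply: Pc.
have a0 : a != 0.
  by apply/eqP => a0; move: e; rewrite a0 c0 mul0r mulr0 subr0 => /eqP; rewrite eq_sym oner_eq0.
(* Adding the first row to the second makes the lower left entry a, which is not 0; the factor with
   entry -1 undoes this. *)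
have da : a * (b + d) - b * a = 1 by rewrite -e c0; ring.
have := PM _ _ (dl (- 1)) _ (PL _) (Pc a b a (b + d) a0 da).
rewrite det_mx2 da => /(_ erefl); rewrite mx2M c0.
by congr (P (mx2 _ _ _ _)); ring.
Qed.

End SpecialLinearGenerators.

(** * Finite checks on the Weil matrices *)

Section FaithfulnessCheck.

(* p times its Galois conjugates: comparing this with an integer certifies that p
   is not 0 without any independence of the powers of z. *)
Definition cyc_norm (p : seq Z) : seq Z :=
  let conj k := mkseq (fun j => nth Z0 p ((j * k) %% 5)) 5 in
  cyc_mul p (cyc_mul (conj 2) (cyc_mul (conj 3) (conj 4))).

(** A norm is rational, so its entries after the first agree and [c] is its integer value. *)
Definition cyc_nonzero (p : seq Z) : bool :=
  let n := cyc_norm p in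
  let c := Z.sub (nth Z0 n 0) (nth Z0 n 1) in
  ~~ Z.eqb c Z0 && cyc_eq n [:: c].

(** The first row alone already distinguishes the identity from every other element. *)
Definition weil_faithful_check : bool :=
  all (fun a => all (fun b => all (fun c => all (fun d =>
    [|| ((a * d + 4 * (b * c)) %% 5 != 1), [&& a == 1, b == 0, c == 0 & d == 1],
        cyc_nonzero (weil_entry a b c d 1 2)
      | cyc_nonzero (form_add Z.add (weil_entry a b c d 1 1)
          (map (Z.mul (-1)) cyc_sqrt5))])
   (iota 0 5)) (iota 0 5)) (iota 0 5)) (iota 0 5).

Lemma weil_faithful_checked : weil_faithful_check.
Proof. by vm_compute. Qed.

Definition weil_det_check (a b c d : nat) : bool :=
  let P := weil_entry a b c d in
  cyc_eq (form_add Z.add (cyc_mul (P 1 1) (P 2 2)) (map (Z.mul (-1)) (cyc_mul (P 1 2) (P 2 1))))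
         (cyc_mul cyc_sqrt5 cyc_sqrt5).

(* With (A, B) the first row of the Fourier transform, (B^5 x^5 - A^5 y^5) *
   (A^5 x^5 + B^5 y^5) is proportional to x^10 + 11 x^5 y^5 - y^10. *)
Definition weil_root_check : bool :=
  let A := weil_entry 0 1 4 0 1 1 in let B := weil_entry 0 1 4 0 1 2 in
  let pow p := cyc_mul p (cyc_mul p (cyc_mul p (cyc_mul p p))) in
  let A5 := pow A in let B5 := pow B in
  [&& cyc_nonzero A, cyc_nonzero B, cyc_eq (weil_entry 0 1 4 0 2 1) B,
    cyc_eq (weil_entry 0 1 4 0 2 2) (map (Z.mul (-1)) A)
  & cyc_eq (cyc_mul B5 B5)
     (form_add Z.add (cyc_mul A5 A5) (map (Z.mul 11) (cyc_mul A5 B5)))].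

Lemma weil_root_checked : weil_root_check.
Proof. by vm_compute. Qed.

End FaithfulnessCheck.

(** * The Weil representation and the matrices preserving a Klein form *)

Section WeilRepresentation.
Import GRing.Theory Num.Theory.
Local Open Scope ring_scope.
Variables (K : numFieldType) (z : K).
Hypothesis z_prim : 5.-primitive_root z.
Local Notation rho := (weil z).
Local Notation SL g := (\det (g : 'M['F_5]_2) = 1).

Lemma weilM g h : SL g -> SL h -> rho (g *m h) = rho g *m rho h.
Proof.
move=> dg; move: g dg h; apply: SL2_ind => [h dh|h dh|g1 g2 d1 d2 IH1 IH2 h dh].
- by apply: weil_mul => //; rewrite !mx2E; apply: weil_mul_check_u.
- by apply: weil_mul => //; rewrite !mx2E; apply: weil_mul_check_w.
- by rewrite -mulmxA IH1 ?det_mulmx ?d2 ?dh ?mulr1 // IH2 // mulmxA -IH1.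
Qed.

Lemma weil_preserves l g : l \in [:: f12; f20; f30] -> SL g -> preserved l (rho g).
Proof.
move=> lI dg; have sl : (0 < size l)%N.
  by move: lI; rewrite !inE => /or3P[] /eqP->.
move: g dg; apply: SL2_ind => [||g h dg dh Pg Ph].
- by apply: weil_preserved => //; rewrite !mx2E; apply: (allP weil_invariant_u).
- by apply: weil_preserved => //; rewrite !mx2E; apply: (allP weil_invariant_w).
- by rewrite weilM //; apply: preservedM.
Qed.

Local Notation rt5 := (sqrt5 z).

Lemma weil_of_cyc (a b c d : 'F_5) (p q r s : seq Z) :
  let E := weil_entry a b c d in
  [&& cyc_eq (E 1 1)%N p, cyc_eq (E 1 2)%N q, cyc_eq (E 2 1)%N r & cyc_eq (E 2 2)%N s] ->
  rho (mx2 a b c d) = rt5^-1 *: mx2 (cyc z p) (cyc z q) (cyc z r) (cyc z s).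
Proof.
move=> E /and4P[]; do 4! move/(cyc_eqP z_prim) => ?.
by apply: matrix2P; rewrite weilE !mx2E mxE mx2E mulrC; congr (_ * _).
Qed.

Lemma weil1 : rho 1%:M = 1%:M.
Proof.
have -> : 1%:M = mx2 1 0 0 1 :> 'M['F_5]_2 by apply: matrix2P; rewrite mx2E mxE.
rewrite (@weil_of_cyc _ _ _ _ cyc_sqrt5 [::] [::] cyc_sqrt5); last by vm_compute.
apply: matrix2P; rewrite !mxE /= ?cyc0 ?mulr0 //; exact: mulVf (sqrt5_neq0 z_prim).
Qed.

Lemma weilN1 : rho (- 1%:M) = - 1%:M.
Proof.
have -> : - 1%:M = mx2 (-1) 0 0 (-1) :> 'M['F_5]_2.
  by apply: matrix2P; rewrite mx2E !mxE ?oppr0.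
pose m := map (Z.mul (-1)) cyc_sqrt5.
rewrite (@weil_of_cyc _ _ _ _ m [::] [::] m); last by vm_compute.
apply: matrix2P; rewrite !mxE /= ?cyc0 ?mulr0 ?oppr0 // cycZ (zrN _ 1) zr1 mulN1r mulrN.
  by rewrite mulVf ?(sqrt5_neq0 z_prim).
by rewrite mulVf ?(sqrt5_neq0 z_prim).
Qed.

Lemma det_weil g : SL g -> \det (rho g) = 1.
Proof.
have D (h : 'M['F_5]_2) : weil_det_check (h 0 0) (h 0 1) (h 1 0) (h 1 1) -> \det (rho h) = 1.
  move/(cyc_eqP z_prim); rewrite cycD cycZ !(cycM z_prim) (zrN _ 1) zr1 mulN1r => e.
  rewrite det2 !weilE; apply: (@mulfI _ (rt5 * rt5)); first by rewrite mulf_neq0 ?sqrt5_neq0.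
  by rewrite mulr1 -[RHS]e; field; rewrite (sqrt5_neq0 z_prim).
move: g; apply: SL2_ind => [||g h dg dh Dg Dh].
- by apply: D; rewrite !mx2E; vm_compute.
- by apply: D; rewrite !mx2E; vm_compute.
- by rewrite weilM // det_mulmx Dg Dh mulr1.
Qed.

Lemma cyc_nonzeroP p : cyc_nonzero p -> cyc z p != 0.
Proof.
case/andP=> n0 /(cyc_eqP z_prim) e; apply/eqP => p0; move: e.
rewrite /cyc_norm (cycM z_prim) p0 mul0r => /eqP; rewrite eq_sym /cyc form_cons /= mulr0 addr0 mulr1.
by apply/negP/zr_neq0 => c0; rewrite c0 in n0.
Qed.

Lemma weil_faithful g : SL g -> rho g = 1%:M -> g = 1%:M.
Proof.
move=> dg e.
have mI (x : 'F_5) : nat_of_ord x \in iota 0 5 by rewrite mem_iota; apply: (ltn_ord x).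
have := allP weil_faithful_checked _ (mI (g 0 0)) => /allP/(_ _ (mI (g 0 1))).
move=> /allP/(_ _ (mI (g 1 0)))/allP/(_ _ (mI (g 1 1)))/or4P[].
- rewrite -(@val_Fp_nat 5) // natrD !natrM !natr_F5.
  have -> : 4 = -1 :> 'F_5 by apply: val_inj.
  by rewrite mulN1r -det2 dg.
- by case/and4P=> /eqP e1 /eqP e2 /eqP e3 /eqP e4; apply: matrix2P; apply: val_inj; rewrite !mxE.
- move/cyc_nonzeroP; have := weilE z g 0 1; rewrite e mxE /= => /esym/eqP.
  by rewrite mulf_eq0 invr_eq0 (negPf (sqrt5_neq0 z_prim)) orbF => ->.
- move/cyc_nonzeroP; rewrite cycD cycZ (zrN _ 1) zr1 mulN1r.
  have := weilE z g 0 0; rewrite e mxE /= => /esym/(congr1 (fun x => x * rt5)).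
  by rewrite mulfVK ?(sqrt5_neq0 z_prim) // mul1r => ->; rewrite subrr eqxx.
Qed.

Lemma weil_u (b : 'F_5) : rho (mx2 1 b 0 1) = mx2 (z ^+ (3 * b)) 0 0 (z ^+ (2 * b)).
Proof.
rewrite (@weil_of_cyc _ _ _ _ (cyc_mul cyc_sqrt5 (cyc_mono ((3 * b) %% 5)%N)) [::] [::]
  (cyc_mul cyc_sqrt5 (cyc_mono ((2 * b) %% 5)%N))); last first.
  by case: b => [[|[|[|[|[|]]]]] bl] //; vm_compute.
rewrite !(cycM z_prim) !cyc_monoE !(prim_expr_mod z_prim).
by apply: matrix2P; rewrite !mxE /= ?cyc0 ?mulr0 // mulKf ?(sqrt5_neq0 z_prim).
Qed.

(* The 12 roots of f12 form one orbit of the Weil representation. *)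
Lemma weil_transitive (x y : K) : form (zr K) f12 x y = 0 ->
  exists2 g, SL g & rho g 1 0 * x + rho g 1 1 * y = 0.
Proof.
move=> f0.
have {}f0 : x * y * (x ^+ 10 + 11 * (x ^+ 5 * y ^+ 5) - y ^+ 10) = 0.
  rewrite -[RHS]f0 /= !zr0 zr1 (zrN _ 1) zr1 /zr.
  have -> : int_of_Z 11 = 11 by [].
  by ring.
(* Multiplication by 2 exchanges the classes of 1 and 2 modulo sign in F_5, so the image of this
   matrix is antidiagonal. *)
have dS : SL (mx2 2 0 0 3) by rewrite det_mx2; apply: val_inj.
have S11 : rho (mx2 2 0 0 3) 1 1 = 0.
  by rewrite weilE !mx2E (_ : weil_entry _ _ _ _ _ _ = [::]) ?cyc0 ?mul0r //; vm_compute.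
have [y0|y0] := eqVneq y 0.
  by exists 1%:M; rewrite ?det1 // weil1 !mxE /= y0 mulr0 mul0r addr0.
have [x0|x0] := eqVneq x 0.
  by exists (mx2 2 0 0 3); rewrite // S11 x0 mulr0 mul0r addr0.
move/eqP: f0; rewrite mulf_eq0 mulf_eq0 (negPf x0) (negPf y0) /= => /eqP f0.
pose w : 'M['F_5]_2 := mx2 0 1 (-1) 0.
have /and5P[nA nB cB cA cAB] := weil_root_checked.
set eA := weil_entry 0 1 4 0 1 1 in nA cA cAB; set eB := weil_entry 0 1 4 0 1 2 in nB cB cAB.
have rw : rho w = rt5^-1 *: mx2 (cyc z eA) (cyc z eB) (cyc z eB) (cyc z (map (Z.mul (-1)) eA)).
  by apply: weil_of_cyc; apply/and4P; split; [vm_compute | vm_compute | exact: cB | exact: cA].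
move: (cyc_nonzeroP nA) (cyc_nonzeroP nB) (cyc_eqP z_prim cAB) rw.
clear nA nB cA cB cAB; clearbody eA eB.
have e11 p q : cyc z (form_add Z.add p (map (Z.mul 11) q)) = cyc z p + zr K 11 * cyc z q.
  by rewrite cycD cycZ.
rewrite e11 !(cycM z_prim) cycZ (zrN _ 1) zr1 mulN1r.
have -> : zr K 11 = 11 by [].
set A := cyc z eA; set B := cyc z eB => A0 B0 AB rw.
have dw : SL w by rewrite det_mx2; ring.
have du b : SL (mx2 1 b 0 1) by rewrite det_mx2; ring.
have ratio (s t : K) : s != 0 -> t ^+ 5 = s ^+ 5 -> exists b : 'F_5, t = z ^+ b * s.
  move=> s0 e; have /(prim_rootP z_prim)[b hb] : (t / s) ^+ 5 = 1.
    by rewrite expr_div_n e divff ?expf_neq0.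
  by exists b; rewrite -hb divfK.
have rwu b : rho (w *m mx2 1 b 0 1) = rt5^-1 *:
    mx2 (A * z ^+ (3 * b)) (B * z ^+ (2 * b)) (B * z ^+ (3 * b)) (- A * z ^+ (2 * b)).
  rewrite weilM // rw weil_u -scalemxAl; congr (_ *: _); rewrite mx2M.
  by congr mx2; rewrite ?mulr0 ?add0r ?addr0.
have zb (b : nat) s : z ^+ (3 * b) * s - z ^+ (2 * b) * (z ^+ b * s) = 0.
  by rewrite [z ^+ (2 * b) * _]mulrA -exprD -mulSnr subrr.
(* By [AB] this product is A^5 B^5 times the factor of degree 10 of [f12]. Each of its two factors
   describes the points at which one coordinate of the image under some w u^b vanishes. *)
have : ((B * x) ^+ 5 - (A * y) ^+ 5) * ((A * x) ^+ 5 - (- (B * y)) ^+ 5) = 0.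
  transitivity (A ^+ 5 * B ^+ 5 * (x ^+ 10 - y ^+ 10) +
      ((B * (B * (B * (B * B)))) * (B * (B * (B * (B * B)))) - A ^+ 10) * (x ^+ 5 * y ^+ 5)).
    by ring.
  rewrite AB; transitivity (A ^+ 5 * B ^+ 5 *
    (x ^+ 10 + 11 * (x ^+ 5 * y ^+ 5) - y ^+ 10)); first by ring.
  by rewrite f0 mulr0.
move/eqP; rewrite mulf_eq0 !subr_eq0 => /orP[] /eqP e.
  have [|b hb] := ratio (B * x) (A * y) _ (esym e); first by rewrite mulf_neq0.
  exists (w *m mx2 1 b 0 1); first by rewrite det_mulmx dw du mulr1.
  rewrite rwu !mxE /=.
  transitivity (rt5^-1 * (z ^+ (3 * b) * (B * x) - z ^+ (2 * b) * (A * y))); first by ring.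
  by rewrite hb zb mulr0.
(* Now the first coordinate of the image vanishes instead of the second; the antidiagonal matrix
   exchanges them. *)
have [|b hb] := ratio (A * x) (- (B * y)) _ (esym e); first by rewrite mulf_neq0.
have dwu : SL (w *m mx2 1 b 0 1) by rewrite det_mulmx dw du mulr1.
exists (mx2 2 0 0 3 *m (w *m mx2 1 b 0 1)); first by rewrite det_mulmx dS dwu mulr1.
rewrite weilM // rwu !mulmx2E S11; set r := rho _ 1 0; rewrite !mxE /=.
transitivity (r * rt5^-1 * (z ^+ (3 * b) * (A * x) - z ^+ (2 * b) * (- (B * y)))); first by ring.
by rewrite hb zb mulr0.
Qed.

(** By [weil_u] the two diagonal entries of a transvection's image have ratio z^b, and these are all
    fifth roots of unity. *)
Lemma diagonal_weil (a d : K) : a != 0 -> d ^+ 5 = a ^+ 5 ->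
  exists nu (b : 'F_5), mx2 a 0 0 d = nu *: rho (mx2 1 b 0 1).
Proof.
move=> a0 e; have /(prim_rootP z_prim)[b hb] : (a / d) ^+ 5 = 1.
  by rewrite expr_div_n e divff ?expf_neq0.
have z0 : z != 0 by rewrite (prim_root_eq0 z_prim).
have d0 : d != 0.
  apply: contra_neq a0 => d0; move/eqP: e.
  by rewrite d0 expr0n eq_sym expf_eq0 => /eqP.
exists (a / z ^+ (3 * b)), b; rewrite weil_u.
have ea : a = z ^+ b * d by rewrite -hb divfK.
apply: matrix2P; rewrite !mxE /= ?mulr0 ?divfK ?expf_neq0 // {1}ea.
by rewrite mulSnr exprD; field; rewrite !expf_neq0.
Qed.

(* f12 vanishes at the image of (1, 0), so by transitivity an element of the
   Weil representation makes B triangular; then it is diagonal. *)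
Lemma preserved_weil l B : l \in [:: f12; f20; f30] -> \det B != 0 -> preserved l B ->
  exists nu g, [/\ SL g, B = nu *: rho g & nu ^+ (size l).-1 = 1].
Proof.
move=> lI dB pB.
have f0 : form (zr K) f12 (B 0 0) (B 1 0) = 0.
  have dB' : B 0 0 * B 1 1 - B 1 0 * B 0 1 != 0 by rewrite [B 1 0 * _]mulrC -det2.
  move: lI pB; rewrite !inE => /or3P[] /eqP->.
  - exact: preserves_f12_root.
  - exact: preserves_f20_root dB'.
  - exact: preserves_f30_root dB'.
have [g dg g0] := weil_transitive f0.
have inv h : SL h -> exists h', [/\ SL h', rho h' *m rho h = 1%:M & rho h *m rho h' = 1%:M].
  move=> dh; have uh : h \in unitmx by rewrite unitmxE dh unitr1.
  have dh' : SL (invmx h) by rewrite det_inv dh invr1.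
  by exists (invmx h); rewrite -!weilM ?mulVmx ?mulmxV ?weil1.
have [g' [dg' g'g _]] := inv g dg.
have pB' : preserved l (rho g *m B) by apply: preservedM => //; apply: weil_preserves.
have dB'' : \det (rho g *m B) != 0 by rewrite det_mulmx det_weil // mul1r.
have c0 : (rho g *m B) 1 0 = 0 by rewrite mulmx2E.
have [a0 d0] : (rho g *m B) 0 0 != 0 /\ (rho g *m B) 1 1 != 0.
  by move: dB''; rewrite det2 c0 mulr0 subr0 mulf_eq0 => /norP.
have [b0 e5] : (rho g *m B) 0 1 = 0 /\ (rho g *m B) 1 1 ^+ 5 = (rho g *m B) 0 0 ^+ 5.
  move: lI pB'; rewrite !inE /preserved c0 => /or3P[] /eqP->.
  - exact: preserves_f12_diagonal.
  - exact: preserves_f20_diagonal.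
  - exact: preserves_f30_diagonal.
have [nu [b e]] := diagonal_weil a0 e5.
have du : SL (mx2 1 b 0 1) by rewrite det_mx2; ring.
have dgu : SL (g' *m mx2 1 b 0 1) by rewrite det_mulmx dg' du mulr1.
have eB : B = nu *: rho (g' *m mx2 1 b 0 1).
  rewrite weilM // scalemxAr -e -[LHS]mul1mx -g'g -mulmxA; congr (_ *m _).
  by rewrite [LHS]mx2_eta c0 b0.
exists nu, (g' *m mx2 1 b 0 1); split=> //.
(* Cancelling the Weil matrix leaves the scalar matrix [nu], which still preserves the form; one
   non-zero coefficient then gives the order of [nu]. *)
have [k [dk _ kV]] := inv _ dgu.
have : preserved l (B *m rho k) by apply: preservedM => //; apply: weil_preserves.
rewrite eB -scalemxAl kV /preserved !mxE /= !mulr1 !mulr0 => pnu.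
move: lI pnu {pB pB'}; rewrite !inE => /or3P[] /eqP-> pnu.
(* [f12] has no term x^12, so its coefficient at x^11 y is used. *)
- by have /= := preserves_coef (k := 1) pnu isT; rewrite -exprD; apply.
- by have /= := preserves_coef (k := 0) pnu isT; rewrite -exprD; apply.
- by have /= := preserves_coef (k := 0) pnu isT; rewrite -exprD; apply.
Qed.

End WeilRepresentation.

(** * Roots of unity, and leading coefficients along lines *)

Section RootsOfUnity.
Import GRing.Theory Num.Theory.
Local Open Scope ring_scope.
Variable K : numClosedFieldType.

Lemma distinct_roots (c : K) n : (0 < n)%N -> c != 0 ->
  exists rs : seq K, [/\ size rs = n, uniq rs & forall r, r \in rs -> r ^+ n = c].
Proof.
move=> n0 c0; pose p : {poly K} := 'X^n - c%:P.
have pm : p \is monic by rewrite monicXnsubC.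
have [rs e] := closed_field_poly_normal p.
move: e; rewrite (monicP pm) scale1r => e.
exists rs; split.
- by apply/succn_inj; rewrite -(size_prod_XsubC rs id) -e size_XnsubC.
- rewrite -separable_prod_XsubC -e separable_poly.unlock derivB derivC subr0 derivXn.
  rewrite -scaler_nat coprimepZr ?pnatr_eq0 -?lt0n //.
  case: n n0 @p {pm e} => // n _ /=.
  apply: coprimep_expr; have cX (q : {poly K}) : coprimep q 'X = ~~ root q 0.
    by rewrite -['X]subr0 -polyC0 coprimep_XsubC.
  by rewrite cX rootE !hornerE expr0n /= sub0r oppr_eq0.
- move=> r; rewrite -root_prod_XsubC -e rootE !hornerE subr_eq0 => /eqP //.
Qed.

Lemma prim_root_exists n : (0 < n)%N -> exists z : K, n.-primitive_root z.
Proof.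
move=> n0; have [rs [sr ur hr]] := distinct_roots n0 (oner_neq0 K).
have /hasP[z _ hz] : has n.-primitive_root rs.
  apply: has_prim_root => //; last by rewrite sr.
  by apply/allP => r /hr e; apply/unity_rootP.
by exists z.
Qed.

End RootsOfUnity.

Section TopCoefficients.
Import GRing.Theory Num.Theory.
Local Open Scope ring_scope.
Variable K : numFieldType.
Local Notation P := {poly K}.

Lemma coef_mul_top (p q : P) m n : (size p <= m.+1)%N -> (size q <= n.+1)%N ->
  (p * q)`_(m + n) = p`_m * q`_n.
Proof.
move=> sp sq; have hm : (m < (m + n).+1)%N by rewrite ltnS leq_addr.
rewrite coefM (bigD1 (Ordinal hm)) //= addKn big1 ?addr0 // => i.
rewrite -val_eqE /= neq_ltn => /orP[] hi.
  by rewrite (nth_default 0 (s := q)) ?mulr0 // (leq_trans sq) //; lia.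
by rewrite (nth_default 0 (s := p)) ?mul0r // (leq_trans sp) //; lia.
Qed.

Lemma size_form_poly l (u v : P) : (size u <= 2)%N -> (size v <= 2)%N ->
  (size (form (zr P) l u v) <= size l)%N.
Proof.
move=> su sv; elim: l => [|a l IH]; first by rewrite size_poly0.
rewrite form_cons (leq_trans (size_polyD _ _)) // geq_max zrC mul_polyC; apply/andP; split.
  apply: (leq_trans (size_scale_leq _ _)); apply: (leq_trans (size_poly_exp_leq _ _)).
  by rewrite ltnS -[leqRHS]mul1n leq_mul2r; case: (size u) su => [|[|[|]]] //; rewrite orbT.
by apply: (leq_trans (size_polyMleq _ _)); rewrite -subn1 leq_subLR (leq_trans (leq_add sv IH)).
Qed.

Lemma form_top_coef l (u v : P) : (size u <= 2)%N -> (size v <= 2)%N ->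
  (0 < size l)%N ->
  (form (zr P) l u v)`_(size l).-1 = form (zr K) l u`_1 v`_1.
Proof.
move=> su sv; elim: l => [|a l IH] // _; rewrite !form_cons coefD zrC coefCM [(size _).-1]/=.
congr (_ * _ + _).
  elim: (size l) => [|n IHn]; first by rewrite !expr0 coef1.
  rewrite !exprS -(add1n n) coef_mul_top // ?IHn //.
  apply: (leq_trans (size_poly_exp_leq _ _)).
  by rewrite ltnS -[leqRHS]mul1n leq_mul2r; case: (size u) su => [|[|[|]]] //; rewrite orbT.
case: l IH => [|b l] IH; first by rewrite /= !mulr0 coef0.
have -> : (size (b :: l)) = (1 + size l)%N by [].
by rewrite coef_mul_top // ?(size_form_poly (b :: l)) // IH.
Qed.

Lemma coef_linear_exp (a b : K) n k : (k <= n)%N ->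
  ((a%:P + b *: 'X) ^+ n)`_k = a ^+ (n - k) * b ^+ k *+ 'C(n, k).
Proof.
move=> kn; rewrite exprDn coef_sum (bigD1 (Ordinal (kn : (k < n.+1)%N))) //=.
rewrite big1 ?addr0 => [|i].
  by rewrite coefMn exprZn -polyC_exp coefCM coefZ coefXn eqxx mulr1.
rewrite -val_eqE /= => ik.
by rewrite coefMn exprZn -polyC_exp coefCM coefZ coefXn eq_sym (negPf ik) !mulr0 mul0rn.
Qed.

End TopCoefficients.

(** * Linear maps preserving the cone *)

Section Automorphisms.
Import GRing.Theory Num.Theory.
Local Open Scope ring_scope.
Variable K : numClosedFieldType.
Local Notation P := {poly K}.

Definition cone (A : comNzRingType) (l : seq Z) (x y z : A) : A :=
  z ^+ (size l).-1 + form (zr A) l x y.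

Lemma horner_cone l (u v w : P) t :
  (cone l u v w).[t] = cone l u.[t] v.[t] w.[t].
Proof. by rewrite /cone hornerD horner_exp horner_form. Qed.

Definition row_image (A : 'M[K]_3) i (x y z : K) : K :=
  A i (inord 0) * x + A i (inord 1) * y + A i (inord 2) * z.

Definition cone_image l (A : 'M[K]_3) (x y z : K) : K :=
  cone l (row_image A (inord 0) x y z) (row_image A (inord 1) x y z)
         (row_image A (inord 2) x y z).

Definition preserves_cone_locus l (A : 'M[K]_3) := forall x y z,
  [|| x != 0, y != 0 | z != 0] ->
  (cone_image l A x y z == 0) = (cone l x y z == 0).

(** The value at the image of (0, 0, 1) is the coefficient of z^d after the substitution, so it is
    the only possible eigenvalue. *)
Definition cone_factor l (A : 'M[K]_3) : K :=
  cone l (A (inord 0) (inord 2)) (A (inord 1) (inord 2)) (A (inord 2) (inord 2)).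

Lemma cone_image_generic l A x y z : (1 < size l)%N ->
  preserves_cone_locus l A -> form (zr K) l x y != 0 ->
  cone_image l A x y z = cone_factor l A * cone l x y z.
Proof.
move=> sl hA f0; set n := (size l).-1.
have n0 : (0 < n)%N by rewrite /n -subn1 subn_gt0.
pose u i : P := (A i (inord 0) * x + A i (inord 1) * y)%:P + A i (inord 2) *: 'X.
pose q : P := cone l (u (inord 0)) (u (inord 1)) (u (inord 2)).
pose r : P := 'X ^+ n + (form (zr K) l x y)%:P.
have qE t : q.[t] = cone_image l A x y t by rewrite horner_cone !hornerE.
have rE t : r.[t] = cone l x y t by rewrite hornerD hornerXn hornerC.
have su i : (size (u i) <= 2)%N.
  rewrite (leq_trans (size_polyD _ _)) // geq_max (leq_trans (size_polyC_leq1 _)) //=.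
  by rewrite (leq_trans (size_scale_leq _ _)) // size_polyX.
have u1 i : (u i)`_1 = A i (inord 2) by rewrite coefD coefC coefZ coefX add0r mulr1.
have qn : q`_n = cone_factor l A.
  rewrite coefD form_top_coef //; last by rewrite (leq_trans _ sl).
  by rewrite !u1 coef_linear_exp // subnn expr0 mul1r binn.
have rn : r`_n = 1 by rewrite coefD coefXn coefC eqxx (gtn_eqF n0) addr0.
have sr : (size r <= n.+1)%N.
  rewrite (leq_trans (size_polyD _ _)) // geq_max size_polyXn leqnn.
  by rewrite (leq_trans (size_polyC_leq1 _)).
have sq : (size q <= n.+1)%N.
  rewrite (leq_trans (size_polyD _ _)) // geq_max; apply/andP; split.
    rewrite (leq_trans (size_poly_exp_leq _ _)) // ltnS -[leqRHS]mul1n leq_mul2r.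
    by case: (size _) (su (inord 2)) => [|[|[|]]] //; rewrite ?orbT.
  by rewrite (leq_trans (size_form_poly _ _ _)) // /n prednK // (leq_trans _ sl).
have [rs [srs urs hrs]] : exists rs : seq K, [/\ size rs = n, uniq rs &
    forall t, t \in rs -> t ^+ n = - form (zr K) l x y].
  by apply: distinct_roots; rewrite ?oppr_eq0.
have nz (t : K) : [|| x != 0, y != 0 | t != 0].
  apply: contra_neqT f0; rewrite !negb_or !negbK => /and3P[/eqP-> /eqP-> _].
  by rewrite form_y0 -/n expr0n (gtn_eqF n0) mulr0.
(* The coefficients at degree n cancel, so a non-zero difference would have degree below n and yet n
   distinct roots. *)
have : q - cone_factor l A *: r = 0.
  apply/eqP/negPn/negP => p0.
  have : (size rs < size (q - cone_factor l A *: r)%R)%N.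
    apply: max_poly_roots => //; apply/allP => t /hrs e.
    have r0 : cone l x y t = 0 by rewrite /cone -/n e addNr.
    rewrite rootE hornerD hornerN hornerZ qE rE r0 mulr0 subr0.
    by rewrite (hA x y t (nz t)) r0.
  rewrite ltnNge srs => /negP[]; apply/leq_sizeP => j.
  rewrite leq_eqVlt => /orP[/eqP<-|nj]; first by rewrite coefB coefZ qn rn mulr1 subrr.
  by rewrite coefB coefZ !nth_default ?mulr0 ?subr0 // (leq_trans _ nj).
move/(congr1 (horner^~ z)); rewrite hornerD hornerN hornerZ horner0 qE rE => /eqP.
by rewrite subr_eq0 => /eqP.
Qed.

(** The condition F(x, y) != 0 is removed by joining (x, y) to a point where F does not vanish:
    along that line F times the discrepancy is zero, and F is not the zero polynomial. *)
Lemma cone_image_scaled l A x y z : (1 < size l)%N ->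
  preserves_cone_locus l A -> (exists x0 y0, form (zr K) l x0 y0 != 0) ->
  cone_image l A x y z = cone_factor l A * cone l x y z.
Proof.
move=> sl hA [x0 [y0 f0]].
pose ux : P := x%:P + (x0 - x) *: 'X; pose uy : P := y%:P + (y0 - y) *: 'X.
pose row i : P := (A i (inord 0))%:P * ux + (A i (inord 1))%:P * uy + (A i (inord 2) * z)%:P.
pose g : P := form (zr P) l ux uy.
pose h : P := cone l (row (inord 0)) (row (inord 1)) (row (inord 2))
  - cone_factor l A *: cone l ux uy z%:P.
have hE t : h.[t] = cone_image l A ux.[t] uy.[t] z - cone_factor l A * cone l ux.[t] uy.[t] z.
  rewrite hornerD hornerN hornerZ !horner_cone hornerC.
  have lin (a b : K) (p q : P) c : (a%:P * p + b%:P * q + c%:P).[t] = a * p.[t] + b * q.[t] + c.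
    by rewrite !hornerE.
  have rowE i : (row i).[t] = row_image A i ux.[t] uy.[t] z.
    exact: lin.
  by rewrite !rowE.
have gh : g * h = 0.
  apply: poly_ext => t; rewrite hornerM horner0 hE horner_form.
  have [->|ft] := eqVneq (form (zr K) l ux.[t] uy.[t]) 0; first by rewrite mul0r.
  by rewrite (cone_image_generic _ sl hA ft) subrr mulr0.
have g0 : g != 0.
  apply: contra_neq f0 => g0; have := congr1 (horner^~ 1) g0.
  have at1 (a b : K) : (a%:P + (b - a) *: 'X).[1] = b.
    by rewrite hornerD hornerC hornerZ hornerX mulr1 addrC subrK.
  by rewrite horner_form !at1 horner0.
have := congr1 (horner^~ 0) (mulfI g0 (etrans gh (esym (mulr0 g)))).
rewrite hE horner0 !horner0_line => /eqP.
by rewrite subr_eq0 => /eqP.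
Qed.

Lemma sum3E (R : nmodType) (F : 'I_3 -> R) :
  \sum_i F i = F (inord 0) + F (inord 1) + F (inord 2).
Proof.
rewrite !big_ord_recl big_ord0 addr0 addrA.
by congr (F _ + F _ + F _); apply: val_inj; rewrite /= inordK.
Qed.

Lemma cone_line_deriv l (p1 p2 p3 q1 q2 q3 : K) :
  (cone l (p1%:P + q1 *: 'X) (p2%:P + q2 *: 'X) (p3%:P + q3 *: 'X))^`().[0] =
  (size l).-1%:R * (p3 ^+ (size l).-2 * q3) +
  (form (zr K) (form_dx l) p1 p2 * q1 + form (zr K) (form_dy l) p1 p2 * q2).
Proof.
rewrite /cone derivD hornerD line_deriv hornerD !hornerM !hornerC !horner_form.
rewrite !horner0_line; congr (_ + _).
rewrite deriv_exp derivD derivC derivZ derivX add0r alg_polyC hornerMn hornerM.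
by rewrite hornerC horner_exp horner0_line mulr_natl mulrC.
Qed.

(* F_x and F_y have no term at k, so a linear form whose (d-1)-st power is
   q1 F_x + q2 F_y involves only one variable; then the terms at j and j-1 give
   q1 = q2 = 0. *)
Definition no_linear_power (l : seq Z) k j :=
  let dx := form_dx l in let dy := form_dy l in
  [&& (0 < k < (size l).-2)%N, (0 < j.-1)%N, (j < (size l).-2)%N,
      Z.eqb (nth Z0 dx k) Z0, Z.eqb (nth Z0 dy k) Z0,
      ~~ Z.eqb (nth Z0 dx j) Z0, Z.eqb (nth Z0 dy j) Z0,
      Z.eqb (nth Z0 dx j.-1) Z0 & ~~ Z.eqb (nth Z0 dy j.-1) Z0].

Lemma linear_power_derivative l k j (a b c q1 q2 : K) : no_linear_power l k j ->
  c != 0 ->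
  (forall t, c * (a + b * t) ^+ (size l).-2 =
    form (zr K) (form_dx l) 1 t * q1 + form (zr K) (form_dy l) 1 t * q2) ->
  [/\ q1 = 0, q2 = 0, a = 0 & b = 0].
Proof.
case/and5P=> /andP[k0 kn] j0 jn /Z.eqb_eq xk /and5P[/Z.eqb_eq yk xj /Z.eqb_eq yj /Z.eqb_eq xj' yj'].
set n := (size l).-2 in kn jn *; move=> c0 h.
have sl : (n < (size l).-1)%N by move: kn; rewrite /n; case: (size l) => [|[|m]].
have e : c%:P * (a%:P + b *: 'X) ^+ n =
    form (zr P) (form_dx l) 1 'X * q1%:P + form (zr P) (form_dy l) 1 'X * q2%:P.
  apply: poly_ext => t; rewrite hornerD !hornerM !hornerC horner_exp !horner_form.
  by rewrite hornerD hornerZ !hornerX !hornerC h.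
have ce i : (i <= n)%N -> c * (a ^+ (n - i) * b ^+ i *+ 'C(n, i)) =
    zr K (nth Z0 (form_dx l) i) * q1 + zr K (nth Z0 (form_dy l) i) * q2.
  move=> ni; have := congr1 (fun p : P => p`_i) e.
  rewrite coefCM coef_linear_exp // coefD !coefMC.
  have := @coef_form K (form_dx l) 1 1 i; rewrite polyC1 scale1r => ->; last first.
    by rewrite size_form_dx (leq_ltn_trans ni).
  have := @coef_form K (form_dy l) 1 1 i; rewrite polyC1 scale1r => ->; last first.
    by rewrite size_form_dy (leq_ltn_trans ni).
  by rewrite !expr1n !mulr1.
have ab : a * b = 0.
  have := ce k (ltnW kn); rewrite xk yk zr0 !mul0r addr0 => /eqP.
  rewrite mulf_eq0 (negPf c0) /= mulrn_eq0 -leqn0 leqNgt bin_gt0 (ltnW kn) /=.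
  rewrite mulf_eq0 !expf_eq0 => /orP[/andP[_ /eqP->]|/andP[_ /eqP->]]; by rewrite ?mul0r ?mulr0.
have z0 i : (0 < i < n)%N -> a ^+ (n - i) * b ^+ i = 0.
  case/andP=> i0 ni; move/eqP: ab; rewrite mulf_eq0 => /orP[] /eqP->.
    by rewrite expr0n subn_eq0 leqNgt ni mul0r.
  by rewrite expr0n (gtn_eqF i0) mulr0.
have q10 : q1 = 0.
  have := ce j (ltnW jn); rewrite z0 ?jn ?(leq_trans j0 (leq_pred _)) // yj zr0 mul0r addr0 mul0rn mulr0.
  move/esym/eqP; rewrite mulf_eq0 => /orP[|/eqP//]; rewrite (negPf (@zr_neq0 K _ _)) // => e0.
  by rewrite e0 in xj.
have q20 : q2 = 0.
  have jn' : (j.-1 < n)%N by apply: leq_ltn_trans jn; apply: leq_pred.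
  have := ce j.-1 (ltnW jn'); rewrite z0 ?jn' ?j0 // xj' zr0 mul0r add0r mul0rn mulr0.
  move/esym/eqP; rewrite mulf_eq0 => /orP[|/eqP//]; rewrite (negPf (@zr_neq0 K _ _)) // => e0.
  by rewrite e0 in yj'.
have a0 : a = 0.
  have := h 0; rewrite q10 q20 !mulr0 !addr0 => /eqP.
  by rewrite mulf_eq0 (negPf c0) expf_eq0 => /andP[_ /eqP].
split=> //; have := h 1; rewrite q10 q20 a0 !mulr0 !addr0 mulr1 add0r => /eqP.
by rewrite mulf_eq0 (negPf c0) expf_eq0 => /andP[_ /eqP].
Qed.

Lemma cone_vertex l k j (A : 'M[K]_3) : no_linear_power l k j -> A \in unitmx ->
  preserves_cone_locus l A -> (exists x0 y0, form (zr K) l x0 y0 != 0) ->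
  [/\ A (inord 0) (inord 2) = 0, A (inord 1) (inord 2) = 0,
      A (inord 2) (inord 0) = 0 & A (inord 2) (inord 1) = 0].
Proof.
move=> nl uA hA f0.
have [sl sl2] : (1 < size l)%N /\ (0 < (size l).-2)%N.
  by move: nl => /andP[/andP[]]; case: (size l) => [|[|[|n]]].
pose w i := invmx A i (inord 2).
have Aw i : row_image A i (w (inord 0)) (w (inord 1)) (w (inord 2)) = (i == inord 2)%:R.
  have := congr1 (fun M : 'M[K]_3 => M i (inord 2)) (mulmxV uA).
  by rewrite mxE sum3E [RHS]mxE.
have i02 : (inord 0 == inord 2 :> 'I_3) = false by rewrite -val_eqE /= !inordK.
have i12 : (inord 1 == inord 2 :> 'I_3) = false by rewrite -val_eqE /= !inordK.
(* The point (0, 0, 1) is off the curve, hence so is its image. *)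
have k0 : cone_factor l A != 0.
  have := hA 0 0 1; rewrite oner_eq0 !orbT => /(_ isT).
  rewrite /cone_image /row_image !mulr0 !mulr1 !add0r => e.
  rewrite /cone_factor e /cone form_y0 expr0n expr1n.
  by rewrite (gtn_eqF (_ : 0 < (size l).-1)%N) -?subn1 ?subn_gt0 // mulr0 addr0 oner_eq0.
have n0 : (size l).-1%:R != 0 :> K by rewrite pnatr_eq0 -lt0n -subn1 subn_gt0.
have [] := @linear_power_derivative l k j (A (inord 2) (inord 0)) (A (inord 2) (inord 1))
    ((size l).-1%:R / cone_factor l A) (w (inord 0)) (w (inord 1)) nl.
- by rewrite mulf_neq0 ?invr_eq0.
- move=> t; pose s i := row_image A i 1 t 0.
  (* Moving along w changes only the last coordinate of the image. Starting from (1, t, 0), the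
     derivative at 0 has no contribution from z^d on the source side and none from F on the target
     side. *)
  have : cone l ((s (inord 0))%:P + 0 *: 'X) ((s (inord 1))%:P + 0 *: 'X) ((s (inord 2))%:P + 1 *: 'X)
      = cone_factor l A *: cone l (1%:P + w (inord 0) *: 'X) (t%:P + w (inord 1) *: 'X)
          (0%:P + w (inord 2) *: 'X).
    apply: poly_ext => r; rewrite hornerZ !horner_cone -cone_image_scaled //.
    have hl (a b : K) : (a%:P + b *: 'X).[r] = a + b * r.
      by rewrite hornerD hornerC hornerZ hornerX.
    rewrite !hl /cone_image; have e i (x y z : K) : row_image A i (1 + w (inord 0) * r)
        (t + w (inord 1) * r) (0 + w (inord 2) * r) = s i + (i == inord 2)%:R * r.
      by rewrite -Aw /s /row_image; ring.
    by rewrite !e // eqxx i02 i12.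
  move/(congr1 (fun p => p^`().[0])); rewrite derivZ hornerZ !cone_line_deriv.
  rewrite !mulr0 !addr0 mulr1 expr0n (gtn_eqF sl2) mul0r mulr0 add0r => e.
  have -> : A (inord 2) (inord 0) + A (inord 2) (inord 1) * t = s (inord 2).
    by rewrite /s /row_image; ring.
  by rewrite mulrAC e mulrC mulKf.
(* As w is now a multiple of (0, 0, 1), [A] fixes that point, which clears the last column. *)
move=> w0 w1 a0 b0; have w2 : w (inord 2) != 0.
  apply/eqP => w2; have := Aw (inord 2); rewrite /row_image w0 w1 w2 !mulr0 !addr0 eqxx.
  by move/esym/eqP; rewrite oner_eq0.
split=> //; apply: (mulIf w2); rewrite mul0r.
  by have := Aw (inord 0); rewrite /row_image w0 w1 !mulr0 !add0r i02.
by have := Aw (inord 1); rewrite /row_image w0 w1 !mulr0 !add0r i12.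
Qed.

End Automorphisms.

(** * From linear maps to automorphism groups *)

Section CurveGroups.
Import GRing.Theory Num.Theory generic_quotient.
Local Open Scope ring_scope.
Local Open Scope quotient_scope.
Variable K : numClosedFieldType.

Lemma isomorphic_sym_of (G H : groupType) (f : H -> G) :
  {morph f : x y / (x * y)%g} -> bijective f -> isomorphic G H.
Proof.
move=> fM [g fK gK].
have gM : {morph g : x y / (x * y)%g}.
  by move=> x y; rewrite -{1}[x]gK -{1}[y]gK -fM fK.
exists (Multiplicative.Pack (Multiplicative.Class (isMultiplicative.Build G H g gM))).
by exists f.
Qed.

Definition affine_mx (B : 'M[K]_2) : 'M[K]_3 := block_mx B 0 0 (1%:M : 'M_1).

Lemma affine_mxM B C : affine_mx (B *m C) = affine_mx B *m affine_mx C.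
Proof.
rewrite [RHS](mulmx_block B 0 0 1%:M C 0 0 1%:M).
by rewrite !mulmx0 !mul0mx !addr0 !mulmx1 add0r.
Qed.

Lemma affine_mx_unit B : \det B != 0 -> affine_mx B \in unitmx.
Proof. by rewrite unitmxE [\det (affine_mx B)](det_ublock B 0 1%:M) det1 mulr1 unitfE. Qed.

Lemma inord_lshift (i : 'I_2) : inord i = lshift 1 i :> 'I_3.
Proof. by apply: val_inj; rewrite /= inordK // (leq_trans (ltn_ord i)). Qed.

Lemma inord_rshift : inord 2 = rshift 2 0 :> 'I_3.
Proof. by apply: val_inj; rewrite /= inordK. Qed.

Lemma affine_mxE B :
  (forall i j : 'I_2, affine_mx B (inord i) (inord j) = B i j) /\
  [/\ forall i : 'I_2, affine_mx B (inord i) (inord 2) = 0,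
      forall j : 'I_2, affine_mx B (inord 2) (inord j) = 0 &
      affine_mx B (inord 2) (inord 2) = 1].
Proof.
split=> [i j|].
  by rewrite !inord_lshift; apply: (block_mxEul B).
split=> [i|j|]; rewrite ?inord_rshift ?inord_lshift.
- by rewrite [LHS](block_mxEur B) mxE.
- by rewrite [LHS](block_mxEdl B) mxE.
- by rewrite [LHS](block_mxEdr B) mxE.
Qed.

Lemma affine_mx_inj : injective affine_mx.
Proof.
move=> B C e; apply/matrixP => i j.
by rewrite -(affine_mxE B).1 -(affine_mxE C).1 e.
Qed.

Lemma row_image_affine B x y z :
  [/\ row_image (affine_mx B) (inord 0) x y z = B 0 0 * x + B 0 1 * y,
      row_image (affine_mx B) (inord 1) x y z = B 1 0 * x + B 1 1 * y &
      row_image (affine_mx B) (inord 2) x y z = z].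
Proof.
have [e1 [e2 e3 e4]] := affine_mxE B.
rewrite /row_image -[0%N]/(nat_of_ord (0 : 'I_2)) -[1%N]/(nat_of_ord (1 : 'I_2)).
by rewrite !e1 !e2 !e3 e4 !mul0r !addr0 add0r mul1r.
Qed.

Lemma affine_mx_preserves l B :
  preserved l B -> forall x y z, cone_image l (affine_mx B) x y z = cone l x y z.
Proof.
move=> pB x y z; have [e0 e1 e2] := row_image_affine B x y z.
by rewrite /cone_image e0 e1 e2 /cone pB.
Qed.

Lemma cone_homog l (c x y z : K) : (0 < size l)%N ->
  cone l (c * x) (c * y) (c * z) = c ^+ (size l).-1 * cone l x y z.
Proof.
move=> sl; rewrite /cone exprMn mulrDr; congr (_ + _).
have [->|c0] := eqVneq c 0.
  rewrite !mul0r form_y0 expr0n; case: l sl => [|a [|b l]] //= _.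
    by rewrite !mulr1 mulr0 addr0 mul1r.
  by rewrite mul0r mulr0.
apply: (mulIf c0); rewrite form_homog mulrAC -exprSr prednK //.
Qed.

Section Parametrisation.
Variables (l : seq Z) (k j : nat) (p : {mpoly K[3]}).
Hypothesis p_cone : forall v : 'I_3 -> K,
  p.@[v] = cone l (v (inord 0)) (v (inord 1)) (v (inord 2)).
Hypothesis sl : (1 < size l)%N.
Hypothesis nl : no_linear_power l k j.
Hypothesis form_nz : exists x y : K, form (zr K) l x y != 0.

Local Notation C := (zero_locus p).

Let sl0 : (0 < size l)%N. Proof. exact: leq_trans sl. Qed.

Lemma zero_locusE (v : hvec K 3) : C (\pi_(proj_space K 3) v)%qT <->
  cone l (val v (inord 0) 0) (val v (inord 1) 0) (val v (inord 2) 0) = 0.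
Proof.
split=> [h|h w /eqP]; first by rewrite -(h v erefl) p_cone.
move/eqP/esym/eqP/pi_projP => [c c0 e]; rewrite p_cone e !mxE cone_homog //.
by rewrite h mulr0.
Qed.

Local Notation pt v := (\pi_(proj_space K 3) v)%qT.
Local Notation cls A := (\pi_(PGL K 3) A)%qT.

Lemma PGL_act_inj (g : PGL K 3) : injective (PGL_act g).
Proof.
apply: (can_inj (g := PGL_act g^-1%g)) => q.
by have := congr1 (fun f => f q) (PGL_actM g^-1%g g); rewrite mulVg PGL_act1 /= => <-.
Qed.

Definition vec3 (x y z : K) : 'cV[K]_3 :=
  \col_i if i == inord 0 then x else if i == inord 1 then y else z.

Lemma vec3E x y z : [/\ vec3 x y z (inord 0) 0 = x, vec3 x y z (inord 1) 0 = y
  & vec3 x y z (inord 2) 0 = z].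
Proof. by split; rewrite mxE -?val_eqE /= ?inordK. Qed.

Lemma vec3_eta (v : 'cV[K]_3) : v = vec3 (v (inord 0) 0) (v (inord 1) 0) (v (inord 2) 0).
Proof.
have [e0 e1 e2] := vec3E (v (inord 0) 0) (v (inord 1) 0) (v (inord 2) 0).
apply/colP => i; case: i => [[|[|[|]]] hi] //.
- by have -> : Ordinal hi = inord 0 by apply: val_inj; rewrite /= inordK.
- by have -> : Ordinal hi = inord 1 by apply: val_inj; rewrite /= inordK.
- by have -> : Ordinal hi = inord 2 by apply: val_inj; rewrite /= inordK.
Qed.

Lemma vec3_neq0 x y z : (vec3 x y z != 0) = [|| x != 0, y != 0 | z != 0].
Proof.
have [e0 e1 e2] := vec3E x y z.
apply/idP/idP; last first.
  by apply: contraTneq => v0; move: e0 e1 e2; rewrite v0 !mxE => <- <- <-; rewrite eqxx.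
apply: contraNT; rewrite !negb_or !negbK => /and3P[/eqP-> /eqP-> /eqP->].
by apply/eqP/colP => i; rewrite !mxE; case: ifP => // _; case: ifP.
Qed.

(** Because the projective action is bijective, equality of C with its image amounts to an
    equivalence at each point. *)
Lemma stabilizesP (A : GL K 3) :
  stabilizes C (cls A) <-> preserves_cone_locus l (val A).
Proof.
have act v : C (PGL_act (cls A) (pt v)) <->
    cone_image l (val A) (val v (inord 0) 0) (val v (inord 1) 0) (val v (inord 2) 0) = 0.
  by rewrite PGL_act_pi zero_locusE /= !mxE !sum3E.
split.
  move/asboolP => e x y z nz; have [e0 e1 e2] := vec3E x y z.
  have vn : vec3 x y z != 0 by rewrite vec3_neq0.
  pose v : hvec K 3 := exist (fun w => is_true (w != 0)) _ vn.
  have := act v; have := zero_locusE v; rewrite /= e0 e1 e2 => h1 h2.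
  apply/eqP/eqP => [/h2 | /h1 h]; last by apply/h2; rewrite -[X in X _]e; exists (pt v).
  by rewrite -[X in X _ -> _]e => -[q Cq /PGL_act_inj eq]; apply/h1; rewrite -eq.
move=> h; have iff q : C (PGL_act (cls A) q) <-> C q.
  elim/proj_ind: q => v; split=> [/act/eqP|/zero_locusE/eqP] e.
    apply/zero_locusE/eqP; rewrite -h //.
    by rewrite -vec3_neq0 -vec3_eta (valP v).
  apply/act/eqP; rewrite h //.
  by rewrite -vec3_neq0 -vec3_eta (valP v).
apply/asboolP/seteqP; split=> [_ [q Cq <-]|q Cq]; first exact/iff.
have e : PGL_act (cls A) (PGL_act (cls A)^-1%g q) = q.
  by have := congr1 (fun f => f q) (PGL_actM (cls A) (cls A)^-1%g); rewrite mulgV PGL_act1 /= => <-.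
by exists (PGL_act (cls A)^-1%g q); rewrite ?e //; apply/iff; rewrite e.
Qed.

Lemma stabilizer_affine (M : 'M[K]_3) :
  M \in unitmx -> preserves_cone_locus l M ->
  exists B c, [/\ c != 0, M = c *: affine_mx B, \det B != 0 & preserved l B].
Proof.
move=> uA h; have [a02 a12 a20 a21] := cone_vertex nl uA h form_nz.
have hs x y z := cone_image_scaled x y z sl h form_nz.
pose c := M (inord 2) (inord 2).
have c0 : c != 0.
  apply: contraTneq uA => c0; rewrite unitmxE unitfE negbK; apply/eqP.
  by rewrite (expand_det_row _ (inord 2)) sum3E a20 a21 [M _ _]c0 !mul0r !addr0.
pose B : 'M[K]_2 := \matrix_(i, j) (c^-1 * M (inord i) (inord j)).
have eM : M = c *: affine_mx B.
  have [e1 [e2 e3 e4]] := affine_mxE B.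
  have ord3 (i : 'I_3) : (exists i' : 'I_2, i = inord i') \/ i = inord 2.
    case: i => [[|[|[|]]] hi] //; [left; exists 0|left; exists 1|right];
      by apply: val_inj; rewrite /= inordK.
  have n2 (i : 'I_2) : i = 0 \/ i = 1.
    by case: i => [[|[|[]]] hi] //; [left|right]; apply: val_inj.
  apply/matrixP => i i'; rewrite mxE.
  case: (ord3 i) => [[a ->]|->]; case: (ord3 i') => [[b ->]|->].
  - by rewrite e1 mxE mulVKf.
  - by rewrite e2 mulr0; case: (n2 a) => ->.
  - by rewrite e3 mulr0; case: (n2 b) => ->.
  - by rewrite e4 mulr1.
exists B, c; split=> //.
  have := uA; rewrite eM unitmxZ ?unitfE //.
  by rewrite unitmxE [\det (affine_mx B)](det_ublock B 0 1%:M) det1 mulr1 unitfE.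
(* The eigenvalue of [M] is c^d, so after division by c the cone is exactly invariant; z = 0 then
   gives the invariance of F. *)
have kc : cone_factor l M = c ^+ (size l).-1.
  rewrite /cone_factor a02 a12 -/c /cone form_y0 expr0n.
  by rewrite (gtn_eqF (_ : 0 < (size l).-1)%N) -?subn1 ?subn_gt0 // mulr0 addr0.
have imc x y z : cone_image l M x y z = c ^+ (size l).-1 * cone_image l (affine_mx B) x y z.
  rewrite eM /cone_image -cone_homog //.
  by congr cone; rewrite /row_image !mxE; ring.
move=> x y; have := hs x y 0; rewrite imc kc => /(mulfI (expf_neq0 _ c0)).
have [e0 e1 e2] := row_image_affine B x y 0; rewrite /cone_image e0 e1 e2.
by move/addrI.
Qed.

Section Group.
Variables (H : groupType) (L : H -> 'M[K]_2).
Hypothesis LM : {morph L : g h / (g * h)%g >-> g *m h}.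
Hypothesis Lp : forall h, preserved l (L h).
Hypothesis Lu : forall h, \det (L h) != 0.
Hypothesis L_inj : forall h, L h = 1%:M -> h = 1%g.
Hypothesis L_surj : forall B, \det B != 0 -> preserved l B -> exists h, L h = B.

Definition affine_GL h : GL K 3 :=
  exist (fun M => is_true (M \in unitmx)) _ (affine_mx_unit (Lu h)).

Lemma affine_GL_stabilizes h : stabilizes C (cls (affine_GL h)).
Proof. by apply/stabilizesP => x y z _; rewrite affine_mx_preserves. Qed.

Definition affine_aut h : Aut_curve C :=
  exist (fun g => is_true (stabilizes C g)) _ (affine_GL_stabilizes h).

Lemma affine_autM : {morph affine_aut : g h / (g * h)%g}.
Proof.
move=> g h; apply: val_inj; rewrite /= [RHS]pi_PGLM; congr (\pi _).
by apply: val_inj; rewrite /= LM affine_mxM.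
Qed.

Lemma affine_aut_bij : bijective affine_aut.
Proof.
have inj : injective affine_aut.
  move=> g h /(congr1 val) /= /eqP/pi_PGLP[c c0] /= e.
  (* Both matrices have lower right entry 1, which pins down the projective scalar. *)
  have c1 : c = 1.
    have [_ [_ _ eg]] := affine_mxE (L g); have [_ [_ _ eh]] := affine_mxE (L h).
    by have := eh; rewrite e mxE eg mulr1.
  move: e; rewrite c1 scale1r => /affine_mx_inj e.
  have L1 : L 1%g = 1%:M.
    have u1 : L 1%g \in unitmx by rewrite unitmxE unitfE Lu.
    by apply: (can_inj (mulKmx u1)); rewrite -LM mulg1 mulmx1.
  apply/esym/(mulgI g^-1%g); rewrite mulVg; apply: L_inj.
  by rewrite LM e -LM mulVg.
have surj (g : Aut_curve C) : exists h, affine_aut h = g.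
  case: g => g sg; have [A eA] : exists A, g = cls A by exists (repr g); rewrite reprK.
  move: sg; rewrite eA => sg.
  have [B [c [c0 e dB pB]]] := stabilizer_affine (valP A) ((stabilizesP A).1 sg).
  have [h hB] := L_surj dB pB; exists h; apply: val_inj => /=.
  by apply/eqP/pi_PGLP; exists c; rewrite //= hB e.
have [f hf] := choice surj.
by exists f => // h; apply: inj; rewrite hf.
Qed.

Lemma Aut_curve_isomorphic : isomorphic (Aut_curve C) H.
Proof. exact: isomorphic_sym_of affine_autM affine_aut_bij. Qed.

End Group.

End Parametrisation.
End CurveGroups.

(** * The order of SL(2,5) and transfer of cardinality *)

Section SL25Facts.
Import GRing.Theory.
Local Open Scope ring_scope.

Lemma SL25_intro (M : 'M['F_5]_2) : \det M = 1 ->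
  exists2 x : {'GL_2['F_5]}, x \in SL25 & GLval x = M.
Proof.
move=> dM; have uM : M \in unitmx by rewrite unitmxE dM unitr1.
by exists (FinRing.Unit (uM : M \is a GRing.unit)); rewrite // inE dM.
Qed.

Lemma SL25_det (x : {'GL_2['F_5]}) : x \in SL25 -> \det (GLval x) = 1.
Proof. by rewrite inE => /eqP. Qed.

Definition GL_det_unit (x : {'GL_2['F_5]}) : {unit 'F_5} :=
  FinRing.unit 'F_5 (etrans (unitfE _) (GL_det x)).

Lemma GL_det_unitM : {in [set: {'GL_2['F_5]}] &, {morph GL_det_unit : x y / (x * y)%g}}.
Proof. by move=> x y _ _; apply: val_inj; rewrite /= -det_mulmx. Qed.

Canonical GL_det_morphism := Morphism GL_det_unitM.

(** SL(2,5) is the kernel of the determinant from a group of order 480 onto the 4 units of F_5. *)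
Lemma card_SL25 : #|SL25| = 120.
Proof.
have kerE : ('ker GL_det_unit)%g = SL25.
  apply/setP => x; rewrite !inE /=; apply/eqP/eqP => [/(congr1 val)//|e].
  exact: val_inj.
have imE : (GL_det_unit @* [set: {'GL_2['F_5]}])%g = [set: {unit 'F_5}].
  apply/setP => u; rewrite inE morphimEdom; apply/imsetP.
  pose M := mx2 (val u) 0 0 1; have uM : M \in unitmx.
    by rewrite unitmxE det_mx2 mulr1 mulr0 subr0 (valP u).
  exists (FinRing.Unit (uM : M \is a GRing.unit)) => //; apply: val_inj.
  by rewrite /= det_mx2 mulr1 mulr0 subr0.
have cG : #|[set: {'GL_2['F_5]}]| = 480 by rewrite card_GL_2 card_Fp.
have := card_morphim GL_det_morphism [set: {'GL_2['F_5]}]%G.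
rewrite imE finset.setTI kerE card_finField_unit card_Fp // => ci.
by have := Lagrange (finset.subsetT SL25_group); rewrite cG -ci => /(congr1 (divn^~ 4)); rewrite mulnK.
Qed.

End SL25Facts.

Section FiniteCardinality.

Lemma isomorphic_card (G H : groupType) (T : finType) (n : nat) :
  isomorphic G H -> (exists f : H -> T, bijective f) -> #|T| = n ->
  ([set: G]%classic #= `I_n)%card.
Proof.
move=> [f bf] [g bg] <-.
have [h _] := PbijTT (bij_comp (@enum_rank_bij T) (bij_comp bg bf)).
exact: card_eq_trans (pcard_eq h) (card_esym card_II).
Qed.

End FiniteCardinality.

(** * The action of Z_2 on SL(2,5) *)

Section SemidirectAction.
Import GRing.Theory.
Local Open Scope ring_scope.

Lemma det_mx_w : \det (mx2 0 1 (-1) 0 : 'M['F_5]_2) = 1.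
Proof. by rewrite det_mx2 mul0r mul1r sub0r opprK. Qed.

Lemma mx_w_unit : (mx2 0 1 (-1) 0 : 'M['F_5]_2) \in unitmx.
Proof. by rewrite unitmxE det_mx_w unitr1. Qed.

Definition gl_w : {'GL_2['F_5]} := FinRing.Unit (mx_w_unit : _ \is a GRing.unit).

Lemma gl_w_SL25 : gl_w \in SL25.
Proof. by rewrite inE det_mx_w. Qed.

Lemma gl_w_sqr : GLval (gl_w * gl_w)%g = - 1%:M.
Proof.
rewrite GL_MxE mx2M; apply: matrix2P; rewrite mx2E !mxE; by apply: val_inj.
Qed.

(** Although w has order 4, its square is the central element -1, so conjugation by w is an
    involution and defines an action of Z_2. *)
Lemma gl_w_sqr_central (x : {'GL_2['F_5]}) : (x ^ (gl_w * gl_w) = x)%g.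
Proof.
apply/conjg_fixP/commgP/val_inj; rewrite -[LHS]/(GLval (x * (gl_w * gl_w))%g).
rewrite -[RHS]/(GLval (gl_w * gl_w * x)%g) (GL_MxE x) (GL_MxE _ x) gl_w_sqr.
by rewrite mulmxN mulNmx mulmx1 mul1mx.
Qed.

End SemidirectAction.

Section ConjugationByZ2.
Variables (gT : finGroupType) (G : {group gT}) (w : gT).
Hypothesis wG : w \in G.
Hypothesis w_sqr_central : forall x, (x ^ (w * w) = x)%g.

(** Trivial outside [G], because a permutation in [Aut G] must fix the complement pointwise. *)
Definition w_act (x : gT) (a : 'Z_2) : gT :=
  if (x \in G) && (a != 1%g) then (x ^ w)%g else x.

Lemma Z2_mul (a b : 'Z_2) : a != 1%g -> b != 1%g -> (a * b = 1)%g.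
Proof.
by case: a b => [[|[|[]]] ha] // [[|[|[]]] hb] // _ _; apply: val_inj.
Qed.

Lemma memJ_w (x : gT) : ((x ^ w)%g \in G) = (x \in G).
Proof. exact/memJ_norm/(fintype.subsetP (normG G)). Qed.

Lemma w_act_is_action : is_action [set: 'Z_2] w_act.
Proof.
split=> [a x y|x a b _ _].
  rewrite /w_act; case: (a != 1%g); rewrite ?andbF ?andbT //.
  have [xS|xS] := boolP (x \in G); have [yS|yS] := boolP (y \in G) => //.
  - exact: conjg_inj.
  - by move=> e; rewrite -e memJ_w xS in yS.
  - by move=> e; rewrite e memJ_w yS in xS.
rewrite /w_act; have [->|a1] := eqVneq a 1%g; first by rewrite mul1g andbF.
have [->|b1] := eqVneq b 1%g; first by rewrite mulg1 a1 andbF.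
rewrite Z2_mul // eqxx andbF andbT; case: (boolP (x \in G)) => xS; last by rewrite (negPf xS).
by rewrite memJ_w xS -conjgM w_sqr_central.
Qed.

Definition w_action := Action w_act_is_action.

Lemma w_action_is_groupAction : is_groupAction G w_action.
Proof.
move=> a _; rewrite inE; apply/andP; split.
  apply/fintype.subsetP => x; rewrite inE actpermE /= /w_act; apply: contraR => /negPf->.
  by rewrite eqxx.
apply/morphicP => x y xS yS; rewrite !actpermE /= /w_act xS yS groupM //=.
by case: ifP => // _; rewrite conjMg.
Qed.

Definition w_groupAction : groupAction [set: 'Z_2]%G G := GroupAction w_action_is_groupAction.

End ConjugationByZ2.

(** * Splitting off the odd scalars *)

Section Parametrisations.
Import GRing.Theory Num.Theory.
Local Open Scope ring_scope.
Variable K : numClosedFieldType.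

Lemma preservedZ l (nu : K) B : (1 < size l)%N -> nu ^+ (size l).-1 = 1 ->
  preserved l B -> preserved l (nu *: B).
Proof.
move=> sl nu1 pB x y; have n0 : nu != 0.
  have [n0|//] := eqVneq nu 0; move/eqP: nu1.
  rewrite n0 expr0n (gtn_eqF (_ : 0 < (size l).-1)%N) ?[false%:R == _]eq_sym ?oner_eq0 //.
  by rewrite -subn1 subn_gt0.
rewrite -[RHS]pB; apply: (mulIf n0); rewrite !mxE -!mulrA -!mulrDr form_homog.
by rewrite -(prednK (ltnW sl)) exprSr nu1 mul1r mulrC.
Qed.

(** Bezout: with u q = v m + 1, the power nu^(u q) is an m-th root of unity and nu^(-v m) a q-th
    one. *)
Lemma coprime_split (om nu : K) q m : (0 < m)%N -> (0 < q)%N -> coprime q m ->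
  m.-primitive_root om -> nu ^+ (q * m) = 1 ->
  exists (sg : K) (i : nat), sg ^+ q = 1 /\ nu = sg * om ^+ i.
Proof.
move=> m0 q0 /eqP cqm om_prim nu1; have [u v e _] := egcdnP m q0; rewrite cqm in e.
have n0 : nu != 0.
  have [n0|//] := eqVneq nu 0; move/eqP: nu1.
  by rewrite n0 expr0n (gtn_eqF (_ : 0 < q * m)%N) ?muln_gt0 ?q0 // eq_sym oner_eq0.
have /(prim_rootP om_prim)[i hi] : (nu ^+ (u * q)) ^+ m = 1.
  by rewrite -exprM -mulnA mulnC exprM nu1 expr1n.
exists (nu ^- (v * m)), i; split.
  by rewrite exprVn -exprM -mulnA [(m * q)%N]mulnC mulnC exprM nu1 expr1n invr1.
by rewrite -hi e exprD expr1 mulKf ?expf_neq0.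
Qed.

Section OddCyclic.
Variables (m : nat) (om : K).
Hypothesis m1 : (1 < m)%N.
Hypothesis m_odd : odd m.
Hypothesis om_prim : m.-primitive_root om.

Lemma om_expM (k i : 'Z_m) : om ^+ (k * i)%g = om ^+ k * om ^+ i.
Proof.
rewrite -exprD -[RHS](prim_expr_mod om_prim).
by congr (_ ^+ _); apply: (congr1 (modn _) (Zp_cast m1)).
Qed.

Lemma om_exp_inZp i : om ^+ (inZp i : 'Z_m) = om ^+ i.
Proof.
rewrite -[RHS](prim_expr_mod om_prim).
by congr (_ ^+ _); apply: (congr1 (modn _) (Zp_cast m1)).
Qed.

Lemma om_sqr_eq1 (k : 'Z_m) : (om ^+ k) ^+ 2 = 1 -> k = 1%g.
Proof.
rewrite -exprM => /eqP; rewrite -(prim_order_dvd om_prim) Gauss_dvdl; last first.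
  by rewrite coprimen2.
move=> mk; apply: val_inj; apply/eqP; rewrite -[_ == _]/((k : nat) == 0%N).
have km : (k < m)%N by rewrite -[X in (_ < X)%N](Zp_cast m1).
by apply: contraLR km; rewrite -lt0n -leqNgt => /dvdn_leq; apply.
Qed.

(** An m-th root of unity cannot be -1 for odd m. This keeps the scalars, of determinant
    [(om ^+ k) ^+ 2], apart from the involution of determinant -1. *)
Lemma om_sqr_neqN1 (k : 'Z_m) : (om ^+ k) ^+ 2 != -1.
Proof.
apply/eqP => e; have : ((om ^+ k) ^+ 2) ^+ m = (-1) ^+ m by rewrite e.
rewrite exprAC [(om ^+ k) ^+ m]exprAC (prim_expr_order om_prim) !expr1n -signr_odd m_odd expr1 => /eqP.
by rewrite -subr_eq0 opprK -[1 + 1]/(2%:R) pnatr_eq0.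
Qed.

Variables (gT : finGroupType) (G : {group gT}) (r : gT -> 'M[K]_2).
Hypothesis rM : {in G &, {morph r : x y / (x * y)%g >-> x *m y}}.
Hypothesis r_det : {in G, forall x, \det (r x) = 1}.
Hypothesis r_faithful : {in G, forall x, r x = 1%:M -> x = 1%g}.
Hypothesis rN : {in G, forall x, exists2 y, y \in G & r y = - r x}.
Hypothesis r_preserves : forall l, l \in [:: f12; f20; f30] ->
  {in G, forall x, preserved l (r x)}.
Hypothesis r_classifies : forall l B, l \in [:: f12; f20; f30] ->
  \det B != 0 -> preserved l B ->
  exists nu x, [/\ x \in G, B = nu *: r x & nu ^+ (size l).-1 = 1].

Lemma scalar_sqr_eq1 (nu : K) x : x \in G -> nu *: r x = 1%:M -> nu ^+ 2 = 1.
Proof.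
move=> xG /(congr1 (fun M : 'M[K]_2 => \det M)).
by rewrite detZ r_det // det1 mulr1.
Qed.

(** Signs are absorbed by the group because its image contains -1. *)
Lemma signed_image (ep : K) x : x \in G -> ep ^+ 2 = 1 ->
  exists2 y, y \in G & r y = ep *: r x.
Proof.
move=> xG /eqP; rewrite sqrf_eq1 => /orP[] /eqP->; last by rewrite scaleN1r; apply: rN.
by exists x; rewrite ?scale1r.
Qed.

Definition direct_rep (u : 'Z_m * [subg G]) : 'M[K]_2 :=
  om ^+ u.1 *: r (sgval u.2).

Lemma direct_repM : {morph direct_rep : g h / (g * h)%g >-> g *m h}.
Proof.
move=> [k [x xS]] [i [y yS]]; rewrite /direct_rep /= om_expM.
by rewrite -scalemxAl -scalemxAr scalerA -rM.
Qed.

Lemma direct_rep_det u : \det (direct_rep u) != 0.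
Proof.
case: u => k [x xS]; rewrite /direct_rep /= detZ r_det // mulr1.
by rewrite !expf_neq0 // (prim_root_eq0 om_prim) gtn_eqF // ltnW.
Qed.

Lemma direct_rep_inj u : direct_rep u = 1%:M -> u = 1%g.
Proof.
case: u => k [x xS]; rewrite /direct_rep /= => e.
have k1 := om_sqr_eq1 (scalar_sqr_eq1 xS e).
move: e; rewrite k1 expr0 scale1r => /(r_faithful xS) x1.
by congr (_, _); apply: val_inj.
Qed.

Lemma direct_rep_preserves l u : l \in [:: f12; f20; f30] ->
  (m %| (size l).-1)%N -> preserved l (direct_rep u).
Proof.
move=> lI ml; case: u => k [x xS]; apply: preservedZ.
- by move: lI; rewrite !inE => /or3P[] /eqP->.
- by rewrite -exprM; apply/eqP; rewrite -(prim_order_dvd om_prim) dvdn_mull.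
- exact: r_preserves.
Qed.

Lemma direct_rep_surj l B : l \in [:: f12; f20; f30] -> (size l).-1 = (2 * m)%N ->
  \det B != 0 -> preserved l B -> exists u, direct_rep u = B.
Proof.
move=> lI sl dB /(r_classifies lI dB)[nu [x [xG -> nu1]]].
have [||sg [i [sg2 ->]]] := @coprime_split om nu 2 m (ltnW m1) isT _ om_prim.
- by rewrite coprime2n.
- by rewrite -sl.
have [y yG ey] := signed_image xG sg2.
exists (inZp i, Subg yG); rewrite /direct_rep /= om_exp_inZp ey.
by rewrite scalerA mulrC.
Qed.

(* The Z_2 factor acts as conjugation by w; it is generated by i r(w), whose
   square is - r(w ^ 2) = 1. *)
Section Semidirect.
Variables (w : gT) (im : K).
Hypothesis wG : w \in G.
Hypothesis w_sqr_central : forall x, (x ^ (w * w) = x)%g.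
Hypothesis r_w_sqr : r (w * w)%g = - 1%:M.
Hypothesis im_sqr : im ^+ 2 = -1.

Definition involution (a : 'Z_2) : 'M[K]_2 := if a == 1%g then 1%:M else im *: r w.

Definition semidirect_rep (u : 'Z_m * sdprod_by (w_groupAction wG w_sqr_central)) : 'M[K]_2 :=
  om ^+ u.1 *: (involution (val u.2).1 *m r (val u.2).2).

Lemma involutionM a b : involution (a * b)%g = involution a *m involution b.
Proof.
rewrite /involution; have [->|a1] := eqVneq a 1%g; first by rewrite mul1g mul1mx.
have [->|b1] := eqVneq b 1%g; first by rewrite mulg1 (negPf a1) mulmx1.
rewrite Z2_mul // eqxx -scalemxAl -scalemxAr scalerA -expr2 im_sqr.
by rewrite -rM // r_w_sqr scaleN1r opprK.
Qed.

Lemma involutionJ x b : x \in G ->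
  r x *m involution b = involution b *m r (w_act G w x b).
Proof.
move=> xG; rewrite /involution /w_act xG; have [_|b1] := eqVneq b 1%g.
  by rewrite mulmx1 mul1mx.
by rewrite /= -scalemxAl -scalemxAr -!rM ?memJ_w // -conjgC.
Qed.

Lemma sdprod_memP (s : sdprod_by (w_groupAction wG w_sqr_central)) : (val s).2 \in G.
Proof. by have := valP s; rewrite inE => /andP[]. Qed.

Lemma semidirect_repM : {morph semidirect_rep : g h / (g * h)%g >-> g *m h}.
Proof.
move=> [k s] [i t]; rewrite /semidirect_rep.
have xS := sdprod_memP s; have yS := sdprod_memP t.
have xJ : w_act G w (val s).2 (val t).1 \in G.
  by have := gact_stable (w_groupAction wG w_sqr_central) (finset.in_setT (val t).1) (val s).2; rewrite xS.
rewrite -[((k, s) * (i, t))%g]/((k * i)%g, (s * t)%g) /fst /snd om_expM.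
rewrite -[val (s * t)%g]/(((val s).1 * (val t).1)%g, (w_act G w (val s).2 (val t).1 * (val t).2)%g).
rewrite /= involutionM rM // -scalemxAl -scalemxAr scalerA; congr (_ *: _).
by rewrite -!mulmxA; congr (_ *m _); rewrite !mulmxA involutionJ.
Qed.

Lemma involution_det a : \det (involution a) = if a == 1%g then 1 else -1.
Proof.
rewrite /involution; case: ifP => _; first by rewrite det1.
by rewrite detZ im_sqr r_det ?mulr1.
Qed.

(** The determinant separates the factors: if it is 1, oddness of m forces first the Z_2 coordinate
    and then the scalar to be trivial. *)
Lemma semidirect_rep_detE u : \det (semidirect_rep u) =
  (om ^+ u.1) ^+ 2 * if (val u.2).1 == 1%g then 1 else -1.
Proof.
by rewrite /semidirect_rep detZ det_mulmx involution_det r_det ?mulr1 // sdprod_memP.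
Qed.

Lemma semidirect_rep_det u : \det (semidirect_rep u) != 0.
Proof.
rewrite semidirect_rep_detE mulf_neq0 //; last by case: ifP; rewrite ?oppr_eq0 oner_eq0.
by rewrite !expf_neq0 // (prim_root_eq0 om_prim) gtn_eqF // ltnW.
Qed.

Lemma semidirect_rep_inj u : semidirect_rep u = 1%:M -> u = 1%g.
Proof.
case: u => k s e; have xS := sdprod_memP s.
have := semidirect_rep_detE (k, s); rewrite e det1 /=.
have [a1 /esym|a1] := eqVneq (val s).1 1%g; last first.
  rewrite mulrN1 => /esym/eqP; rewrite eqr_oppLR => /eqP k2.
  by have := om_sqr_neqN1 k; rewrite k2 eqxx.
rewrite mulr1 => /om_sqr_eq1 k1; move: e; rewrite /semidirect_rep /= k1 expr0 scale1r.
rewrite /involution a1 eqxx mul1mx => /(r_faithful xS) x1.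
congr (_, _); apply: val_inj; rewrite /= [LHS]surjective_pairing.
by rewrite -[(pair_of_sd s).1]/((val s).1) a1 -[(pair_of_sd s).2]/((val s).2) x1.
Qed.

Lemma semidirect_rep_preserves l u : l \in [:: f12; f20; f30] ->
  (size l).-1 = (4 * m)%N -> preserved l (semidirect_rep u).
Proof.
move=> lI sl; case: u => k s; have xS := sdprod_memP s.
have l1 : (1 < size l)%N by move: lI; rewrite !inE => /or3P[] /eqP->.
apply: preservedZ => //.
  by rewrite -exprM sl; apply/eqP; rewrite -(prim_order_dvd om_prim) !dvdn_mull.
apply: preservedM; last exact: r_preserves.
rewrite /involution; case: ifP => _; first by move=> x y; rewrite !mxE /= !mul1r !mul0r addr0 add0r.
apply: preservedZ => //; last exact: r_preserves.
by rewrite sl exprM (_ : im ^+ 4 = 1) ?expr1n // -[4%N]/(2 * 2)%N exprM im_sqr sqrrN expr1n.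
Qed.

Lemma semidirect_rep_surj l B : l \in [:: f12; f20; f30] -> (size l).-1 = (4 * m)%N ->
  \det B != 0 -> preserved l B -> exists u, semidirect_rep u = B.
Proof.
move=> lI sl dB /(r_classifies lI dB)[nu [x [xG -> nu1]]].
have [||sg [i [sg4 ->]]] := @coprime_split om nu 4 m (ltnW m1) isT _ om_prim.
- by rewrite -[4%N]/(2 ^ 2)%N coprime_pexpl // coprime2n.
- by rewrite -sl.
suff [a [y [yG e]]] : exists a y, y \in G /\ involution a *m r y = sg *: r x.
  have sdI : (a, y) \in finset.setX [set: 'Z_2]%G G by rewrite inE finset.in_setT yG.
  exists (inZp i, SdPair (w_groupAction wG w_sqr_central) sdI).
  by rewrite /semidirect_rep /= om_exp_inZp e scalerA mulrC.
have : (sg ^+ 2) ^+ 2 = 1 by rewrite -exprM.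
move/eqP; rewrite sqrf_eq1 => /orP[] /eqP sg2.
  have [y yG e] := signed_image xG sg2.
  by exists 1%g, y; split; rewrite // /involution eqxx mul1mx.
(* Here sg^2 = -1, so -i sg is a sign and goes into [y]. The missing factor i comes from the
   involution, whose r(w) is cancelled by w^-1. *)
have [|y yG e] := @signed_image (- im * sg) x xG.
  by rewrite exprMn sqrrN im_sqr sg2 mulrNN mulr1.
exists Zp1, (w^-1 * y)%g; split; first by rewrite groupM ?groupV.
have -> : involution Zp1 = im *: r w by [].
rewrite -scalemxAl -rM ?groupM ?groupV // mulKVg e scalerA.
by rewrite mulrA mulrN -expr2 im_sqr opprK mul1r.
Qed.

End Semidirect.

End OddCyclic.

End Parametrisations.

(** * The three curves *)

Section CurveEquations.
Import GRing.Theory Num.Theory.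
Local Open Scope ring_scope.
Variable K : numClosedFieldType.

Lemma zrE n c : Z.of_nat n = c -> zr K c = n%:R.
Proof. by move<-; apply: zr_nat. Qed.

Lemma meval_cone12 (v : 'I_3 -> K) : ('X_(inord 2) ^+ 12 + F12 K).@[v] =
  cone f12 (v (inord 0)) (v (inord 1)) (v (inord 2)).
Proof.
have e11 : zr K 11 = 11%:R by apply: zrE; vm_compute.
(* Coordinates are rewritten as values of the variables, which are then generalised, so that [ring]
   only has to push evaluation through. *)
rewrite -!(mevalXU v) /cone /F12; move: ('X_(inord 0)) ('X_(inord 1)) ('X_(inord 2)) => X Y Z.
rewrite /f12 [form _ _ _ _]/= (zrN _ 1) zr0 zr1 e11.
ring.
Qed.

Lemma meval_cone20 (v : 'I_3 -> K) : ('X_(inord 2) ^+ 20 + F20 K).@[v] =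
  cone f20 (v (inord 0)) (v (inord 1)) (v (inord 2)).
Proof.
have e228 : zr K 228 = 228%:R by apply: zrE; vm_compute.
have e494 : zr K 494 = 494%:R by apply: zrE; vm_compute.
rewrite -!(mevalXU v) /cone /F20; move: ('X_(inord 0)) ('X_(inord 1)) ('X_(inord 2)) => X Y Z.
rewrite /f20 [form _ _ _ _]/= (zrN _ 228) zr0 zr1 e228 e494.
ring.
Qed.

Lemma meval_cone30 (v : 'I_3 -> K) : ('X_(inord 2) ^+ 30 + F30 K).@[v] =
  cone f30 (v (inord 0)) (v (inord 1)) (v (inord 2)).
Proof.
have e522 : zr K 522 = 522%:R by apply: zrE; vm_compute.
have e10005 : zr K 10005 = 10005%:R by apply: zrE; vm_compute.
rewrite -!(mevalXU v) /cone /F30; move: ('X_(inord 0)) ('X_(inord 1)) ('X_(inord 2)) => X Y Z.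
rewrite /f30 [form _ _ _ _]/= (zrN _ 522) (zrN _ 10005) zr0 zr1 e522 e10005.
ring.
Qed.

Lemma Klein_form_nz l : l \in [:: f12; f20; f30] ->
  exists x y : K, form (zr K) l x y != 0.
Proof.
rewrite !inE => /or3P[] /eqP->; [exists 1, 1 | exists 1, 0 | exists 1, 0].
- have e11 : zr K 11 = 11%:R by apply: zrE; vm_compute.
  have -> : form (zr K) f12 1 1 = 11%:R.
    by rewrite /f12 [form _ _ _ _]/= (zrN _ 1) zr0 zr1 e11; ring.
  by rewrite pnatr_eq0.
- by rewrite form_y0 expr1n mulr1 zr1 oner_eq0.
- by rewrite form_y0 expr1n mulr1 zr1 oner_eq0.
Qed.

Section IcosahedralGroup.
Variable z : K.
Hypothesis z_prim : 5.-primitive_root z.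

Definition weil_GL (x : {'GL_2['F_5]}) : 'M[K]_2 := weil z (GLval x).

Lemma weil_GL_M : {in SL25 &, {morph weil_GL : x y / (x * y)%g >-> x *m y}}.
Proof. by move=> x y /SL25_det dx /SL25_det dy; apply: (weilM z_prim dx dy). Qed.

Lemma weil_GL_det : {in SL25, forall x, \det (weil_GL x) = 1}.
Proof. by move=> x /SL25_det; apply: det_weil. Qed.

Lemma weil_GL_faithful : {in SL25, forall x, weil_GL x = 1%:M -> x = 1%g}.
Proof. by move=> x /SL25_det dx /(weil_faithful z_prim dx) e; apply: val_inj. Qed.

Lemma weil_GL_N : {in SL25, forall x, exists2 y, y \in SL25 & weil_GL y = - weil_GL x}.
Proof.
move=> x /SL25_det dx; have dN : \det (- GLval x) = 1.
  by rewrite -scaleN1r detZ dx sqrrN expr1n mulr1.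
have d1 : \det (- 1%:M : 'M['F_5]_2) = 1 by rewrite -scaleN1r detZ det1 sqrrN expr1n mulr1.
have [y yS yE] := SL25_intro dN; exists y; rewrite // /weil_GL yE.
by rewrite -[GLval x in LHS]mul1mx -mulNmx weilM // weilN1 // mulNmx mul1mx.
Qed.

Lemma weil_GL_preserves l : l \in [:: f12; f20; f30] ->
  {in SL25, forall x, preserved l (weil_GL x)}.
Proof. by move=> lI x /SL25_det dx; apply: weil_preserves. Qed.

Lemma weil_GL_classifies l B : l \in [:: f12; f20; f30] ->
  \det B != 0 -> preserved l B ->
  exists nu x, [/\ x \in SL25, B = nu *: weil_GL x & nu ^+ (size l).-1 = 1].
Proof.
move=> lI dB /(preserved_weil z_prim lI dB)[nu [g [/SL25_intro[x xS xg] e nu1]]].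
by exists nu, x; split; rewrite // /weil_GL xg.
Qed.

Lemma weil_GL_w_sqr : weil_GL (gl_w * gl_w)%g = - 1%:M.
Proof. by rewrite /weil_GL gl_w_sqr; apply: weilN1. Qed.

End IcosahedralGroup.

Lemma Aut_C30 : isomorphic (Aut_curve (C30 K)) ('Z_15 * [subg SL25])%type.
Proof.
have [z z_prim] := prim_root_exists K (isT : 0 < 5)%N.
have [om om_prim] := prim_root_exists K (isT : 0 < 15)%N.
have lI : f30 \in [:: f12; f20; f30] by rewrite !inE eqxx !orbT.
(* Neither y nor y^2 occurs at x = 1, which clears index 1 of both derivatives; index 5 comes from
   the term in x^25 y^5. *)
have nl : no_linear_power f30 1 5 by vm_compute.
apply: (Aut_curve_isomorphic meval_cone30 isT nl (Klein_form_nz lI)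
  (L := direct_rep om (weil_GL z))).
- apply: (direct_repM (m := 15) isT om_prim); exact: weil_GL_M z_prim.
- move=> u; apply: (direct_rep_preserves om_prim _ u lI isT); exact: weil_GL_preserves.
- apply: (direct_rep_det (m := 15) isT om_prim); exact: weil_GL_det.
- move=> u; apply: (direct_rep_inj (m := 15) isT isT om_prim) => //.
  + exact: weil_GL_det z_prim.
  + exact: weil_GL_faithful z_prim.
- move=> B dB pB; apply: (direct_rep_surj (m := 15) isT isT om_prim _ _ lI) => //.
  + exact: weil_GL_N z_prim.
  + exact: weil_GL_classifies z_prim.
Qed.

Definition SL25_action : groupAction [set: 'Z_2]%G SL25 :=
  w_groupAction gl_w_SL25 gl_w_sqr_central.

Lemma Aut_Z4 m l k j (p : {mpoly K[3]}) : (1 < m)%N -> odd m ->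
  l \in [:: f12; f20; f30] -> (size l).-1 = (4 * m)%N -> no_linear_power l k j ->
  (forall v : 'I_3 -> K, p.@[v] = cone l (v (inord 0)) (v (inord 1)) (v (inord 2))) ->
  isomorphic (Aut_curve (zero_locus p)) ('Z_m * sdprod_by SL25_action)%type.
Proof.
move=> m1 mo lI sl nl pE.
have [z z_prim] := prim_root_exists K (isT : 0 < 5)%N.
have [om om_prim] := prim_root_exists K (ltnW m1).
have l1 : (1 < size l)%N by move: lI; rewrite !inE => /or3P[] /eqP->.
have wS := weil_GL_w_sqr z_prim; have i2 := @sqrCi K.
apply: (Aut_curve_isomorphic pE l1 nl (Klein_form_nz lI)
  (L := @semidirect_rep K m om _ SL25_group (weil_GL z) gl_w 'i gl_w_SL25 gl_w_sqr_central)).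
- apply: (semidirect_repM m1 om_prim) => //; exact: weil_GL_M z_prim.
- move=> u; apply: (semidirect_rep_preserves om_prim) => //; exact: weil_GL_preserves.
- apply: (semidirect_rep_det m1 om_prim) => //; exact: weil_GL_det.
- move=> u; apply: (semidirect_rep_inj m1 mo om_prim) => //.
  + exact: weil_GL_det z_prim.
  + exact: weil_GL_faithful z_prim.
- move=> B dB pB; exact: (semidirect_rep_surj (G := SL25_group) m1 mo om_prim
    (weil_GL_M z_prim) (weil_GL_N z_prim) (weil_GL_classifies z_prim)
    gl_w_SL25 gl_w_sqr_central i2 lI sl dB pB).
Qed.

Lemma Aut_C20 : isomorphic (Aut_curve (C20 K)) ('Z_5 * sdprod_by SL25_action)%type.
Proof. by apply: (@Aut_Z4 5 f20 1 5) meval_cone20; vm_compute. Qed.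

(** The term x^11 y occupies index 1 of F_x, so the gap is taken at 2; index 6 comes from 11 x^6
    y^6. *)
Lemma Aut_C12 : isomorphic (Aut_curve (C12 K)) ('Z_3 * sdprod_by SL25_action)%type.
Proof. by apply: (@Aut_Z4 3 f12 2 6) meval_cone12; vm_compute. Qed.

End CurveEquations.

(** * Orders of the automorphism groups *)

Lemma card_subg (gT : finGroupType) (G : {group gT}) : #|{: [subg G]}| = #|G|.
Proof. by rewrite card_sub; apply: eq_card => x; rewrite inE. Qed.

Lemma card_sdprod_by (aT rT : finGroupType) (D : {group aT}) (G : {group rT})
  (to : groupAction D G) : #|{: sdprod_by to}| = (#|D| * #|G|)%N.
Proof. by rewrite card_sub -cardsX; apply: eq_card => x; rewrite inE. Qed.

Lemma card_Zn n : (1 < n)%N -> #|'Z_n| = n.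
Proof. by move=> n1; rewrite card_ord Zp_cast. Qed.

Theorem theorem5 (R : realType) :
  ([set: Aut_curve (C30 R[i])]%classic #= `I_(60 * 30))%card /\
  ([set: Aut_curve (C20 R[i])]%classic #= `I_(60 * 20))%card /\
  ([set: Aut_curve (C12 R[i])]%classic #= `I_(60 * 12))%card /\
  isomorphic (Aut_curve (C30 R[i])) ('Z_15 * [subg SL25])%type /\
  (exists to : groupAction [set: 'Z_2]%G SL25,
    isomorphic (Aut_curve (C20 R[i])) ('Z_5 * sdprod_by to)%type) /\
  (exists to : groupAction [set: 'Z_2]%G SL25,
    isomorphic (Aut_curve (C12 R[i])) ('Z_3 * sdprod_by to)%type).
Proof.
have h30 := Aut_C30 (R[i]); have h20 := Aut_C20 (R[i]); have h12 := Aut_C12 (R[i]).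
have c2 : #|{: sdprod_by SL25_action}| = 240.
  by rewrite card_sdprod_by cardsT card_Zn // card_SL25.
split; [|split; [|split; [|split; [exact: h30|split; exists SL25_action]]]] => //.
- apply: (isomorphic_card h30 (T := ('Z_15 * [subg SL25])%type)); first by exists id; exists id.
  by rewrite card_prod card_Zn // card_subg card_SL25.
- apply: (isomorphic_card h20 (T := ('Z_5 * sdprod_by SL25_action)%type)); first by exists id; exists id.
  by rewrite card_prod card_Zn // c2.
- apply: (isomorphic_card h12 (T := ('Z_3 * sdprod_by SL25_action)%type)); first by exists id; exists id.
  by rewrite card_prod card_Zn // c2.
Qed.
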